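(* Let $\Phi$ be an irreducible crystallographic root system of a Weyl group, with positive system $\Phi^+$ and simple system $\Pi$, and let $\widetilde{W}$ be the corresponding irreducible affine Weyl group. The map $u\mapsto\Phi_u$ gives (1) a bijection between $\widetilde{W}_l$ (the infinite reduced words of $\widetilde W$) and the following subset of $\mathscr{B}(\widehat{\Phi})$: $$\{w\cdot\widehat{\Phi^+_{L,\emptyset}} : w\in\widetilde{W},\ L\subsetneq\Pi\};$$ (2) a bijection between $\overline{\widetilde{W}}$ and the following subset of $\mathscr{B}(\widehat{\Phi})$: $$\{w\cdot\widehat{\Phi^+_{L,\emptyset}} : w\in\widetilde{W},\ L\subset\Pi\}.$$
   Context: Affine setting: $\Phi$ is finite and reduced, spanning a Euclidean space $V$ with inner product $(\cdot,\cdot)$; $\Phi^-=-\Phi^+$. Let $V'=V\oplus\mathbb{R}\delta$, with the inner product extended by $(\delta,V')=0$. For $\alpha\in\Phi^+$ let $\widehat{\alpha}=\{\alpha+n\delta : n\in\mathbb{Z}_{\ge0}\}$; for $\alpha\in\Phi^-$ let $\widehat{\alpha}=\{\alpha+(n+1)\delta : n\in\mathbb{Z}_{\ge0}\}$; for $\Gamma\subset\Phi$ let $\widehat{\Gamma}=\bigcup_{\alpha\in\Gamma}\widehat{\alpha}$. The affine Weyl group $\widetilde{W}$ is the Coxeter group generated by the reflections $s_\rho(v)=v-\frac{2(v,\rho)}{(\rho,\rho)}\rho$ of $V'$, $\rho\in\widehat\Phi$; its root system is $\widetilde\Phi=\widehat{\Phi}\cup-\widehat{\Phi}$, positive system $\widetilde\Phi^+=\widehat{\Phi}$,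 simple roots $\Pi\cup\{\delta-\gamma\}$ with $\gamma$ the highest root of $\Phi$; the simple reflections are the Coxeter generators. Inversion sets and infinite words: for $x\in\widetilde W$, $\Phi_x=\{\rho\in\widehat\Phi : x^{-1}(\rho)\in-\widehat\Phi\}$. An infinite reduced expression is a sequence $s_1s_2\cdots$ of simple reflections all of whose finite initial segments $s_1\cdots s_k$ are reduced expressions; $\Phi_{s_1s_2\cdots}=\bigcup_i\Phi_{s_1\cdots s_i}$. Two infinite reduced expressions are equivalent if these sets coincide; $\widetilde W_l$ is the set of equivalence classes (infinite reduced words), $\Phi_u$ for $u\in\widetilde W_l$ is the common set, and $\overline{\widetilde W}=\widetilde W_l\uplus\widetilde W$. Biclosed sets: $\Gamma\subset\widehat\Phi$ is closed if $\alpha,\beta\in\Gamma$, $k_1,k_2\in\mathbb{R}_{\ge0}$ and $k_1\alpha+k_2\beta\in\widehat\Phi$ imply $k_1\alpha+k_2\beta\in\Gamma$; it is biclosed if both $\Gamma$ and $\widehat\Phi\setminus\Gamma$ are closed. $\mathscr{B}(\widehat\Phi)$ is the set of biclosed subsets of $\widehat\Phi$. $\widetilde W$ acts on $\mathscr{B}(\widehat\Phi)$ by $x\cdot\Gamma=(\Phi_x\setminus x(-\Gamma))\cup(x(\Gamma)\setminus(-\Phi_x))$. For $L\subset\Pi$, $\Phi^+_{L,\emptyset}=\Phi^+\setminus\Phi_L$, where $\Phi_L$ is the root subsystem of $\Phi$ generated by $L$. *)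

(* Defs.v *)
From HB Require Import structures.
From mathcomp Require Import all_boot all_order all_algebra finmap.
From mathcomp Require Import boolp classical_sets functions cardinality fsbigop.
From mathcomp Require Import reals.

Set Implicit Arguments.
Unset Strict Implicit.
Unset Printing Implicit Defensive.

Import Order.TTheory GRing.Theory Num.Theory.

Local Open Scope classical_set_scope.
Local Open Scope ring_scope.

Definition reflection (R : realType) (U : lmodType R) (f : U -> U -> R)
    (a v : U) : U :=
  v - (2 * f v a / f a a) *: a.

Section FiniteRootSystems.
Context (R : realType) (V : vectType R) (dot : {dot V for idfun}).

Record crystallographic_root_system (Phi : set V) : Prop := {
  roots_finite : finite_set Phi;
  roots_span : <<fset_set Phi>>%VS = fullv;
  roots_neq0 : ~ Phi 0;
  roots_reflection :
    forall a b, Phi a -> Phi b -> Phi (reflection dot a b);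
  roots_reduced :
    forall (a : V) (c : R), Phi a -> Phi (c *: a) -> c = 1 \/ c = - 1;
  roots_integral :
    forall a b, Phi a -> Phi b -> 2 * dot b a / dot a a \is a Num.int }.

Definition irreducible_roots (Phi : set V) : Prop :=
  Phi !=set0 /\
  ~ (exists A B : set V,
       [/\ A !=set0, B !=set0, A `|` B = Phi &
           forall a b, A a -> B b -> dot a b = 0]).

Definition nonneg_cone (Pi : set V) : set V :=
  [set v | exists2 c : V -> R, (forall p, Pi p -> 0 <= c p) &
           v = \sum_(p \in Pi) c p *: p].

Definition simple_system (Phi Pi : set V) : Prop :=
  [/\ Pi `<=` Phi, free (fset_set Pi) &
      forall a, Phi a -> nonneg_cone Pi a \/ nonneg_cone Pi (- a)].

Definition positive_roots (Phi Pi : set V) : set V :=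
  Phi `&` nonneg_cone Pi.

Definition highest_root (Phi Pi : set V) (gamma : V) : Prop :=
  Phi gamma /\ forall a, Phi a -> nonneg_cone Pi (gamma - a).

Definition root_subsystem (Phi Psi : set V) : Prop :=
  Psi `<=` Phi /\ forall a b, Psi a -> Psi b -> Psi (reflection dot a b).

Definition generated_subsystem (Phi L : set V) : set V :=
  smallest (root_subsystem Phi) L.

(* The set written Phi^+_{L, empty} in the literature. *)
Definition positive_off (Phi Pi L : set V) : set V :=
  positive_roots Phi Pi `\` generated_subsystem Phi L.

End FiniteRootSystems.

Section AffineRootSystems.
Context (R : realType) (V : vectType R) (dot : {dot V for idfun}).

(* V' = V (+) R delta; the pair (v, c) stands for v + c delta. *)
Definition affine_space : vectType R := (V * R^o)%type.

(* The extended form is degenerate: delta = (0, 1) spans its radical. *)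
Definition affine_form (u v : affine_space) : R := dot u.1 v.1.

Lemma affine_reflection_linear (rho : affine_space) :
  linear (reflection affine_form rho).
Proof.
move=> k u v; rewrite /reflection /affine_form /= linearDl linearZl_LR /=.
rewrite scalerBr scalerA addrACA -opprD -scalerDl; congr (_ - _ *: _).
by rewrite mulrDr mulrDl mulrCA !mulrA.
Qed.

HB.instance Definition _ (rho : affine_space) :=
  GRing.isLinear.Build R affine_space affine_space _
    (reflection affine_form rho) (affine_reflection_linear rho).

Definition affine_reflection (rho : affine_space) : 'End(affine_space) :=
  linfun (reflection affine_form rho).

Lemma affine_reflectionE (rho v : affine_space) :
  affine_reflection rho v = v - (2 * dot v.1 rho.1 / dot rho.1 rho.1) *: rho.
Proof. by rewrite lfunE. Qed.

Definition is_subgroup (G : set 'End(affine_space)) : Prop :=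
  [/\ G \1%VF, (forall x y, G x -> G y -> G (x \o y)%VF) &
      forall x, G x -> G (x^-1)%VF].

Definition opp_set (A : set affine_space) : set affine_space :=
  [set - v | v in A].

Variables Phi Pi : set V.

Definition hat (Gamma : set V) : set affine_space :=
  [set rho | exists a n, Gamma a /\
     ((positive_roots Phi Pi a /\ rho = (a, n%:R)) \/
      (positive_roots Phi Pi (- a) /\ rho = (a, n.+1%:R)))].

Definition affine_weyl : set 'End(affine_space) :=
  smallest is_subgroup (affine_reflection @` hat Phi).

(* Elements of affine_weyl are bijective, so that x^-1 is the true inverse. *)
Definition inversions (x : 'End(affine_space)) : set affine_space :=
  [set rho | hat Phi rho /\ opp_set (hat Phi) ((x^-1)%VF rho)].

Definition closed_roots (Gamma : set affine_space) : Prop :=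
  forall a b (k1 k2 : R), Gamma a -> Gamma b -> 0 <= k1 -> 0 <= k2 ->
    hat Phi (k1 *: a + k2 *: b) -> Gamma (k1 *: a + k2 *: b).

Definition biclosed : set (set affine_space) :=
  [set Gamma | [/\ Gamma `<=` hat Phi, closed_roots Gamma &
                   closed_roots (hat Phi `\` Gamma)]].

Definition biclosed_action (x : 'End(affine_space)) (Gamma : set affine_space) :
    set affine_space :=
  (inversions x `\` x @` opp_set Gamma) `|`
  (x @` Gamma `\` opp_set (inversions x)).

Definition orbit_sets : set (set affine_space) :=
  [set Gamma | exists w L, [/\ affine_weyl w, L `<=` Pi &
     Gamma = biclosed_action w (hat (positive_off dot Phi Pi L))]].

Definition proper_orbit_sets : set (set affine_space) :=
  [set Gamma | exists w L, [/\ affine_weyl w, L `<` Pi &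
     Gamma = biclosed_action w (hat (positive_off dot Phi Pi L))]].

Variable gamma : V.

Definition affine_simple_roots : set affine_space :=
  [set (p, 0) | p in Pi] `|` [set (- gamma, 1)].

Definition simple_reflections : set 'End(affine_space) :=
  affine_reflection @` affine_simple_roots.

Definition word_prod (s : seq 'End(affine_space)) : 'End(affine_space) :=
  foldr (fun x y => (x \o y)%VF) \1%VF s.

Definition simple_word (s : seq 'End(affine_space)) : Prop :=
  forall x, x \in s -> simple_reflections x.

Definition reduced (s : seq 'End(affine_space)) : Prop :=
  simple_word s /\
  forall t, simple_word t -> word_prod t = word_prod s -> (size s <= size t)%N.

Definition infinite_reduced (s : nat -> 'End(affine_space)) : Prop :=
  forall k, reduced (mkseq s k).

Definition expression_inversions (s : nat -> 'End(affine_space)) :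
    set affine_space :=
  \bigcup_k inversions (word_prod (mkseq s k)).

(* An infinite reduced word is an equivalence class of expressions. *)
Definition infinite_words : set (set (nat -> 'End(affine_space))) :=
  [set u | exists2 s, infinite_reduced s &
     u = [set t | infinite_reduced t /\
                  expression_inversions t = expression_inversions s]].

(* On a class u this is the inversion set shared by all its expressions. *)
Definition word_inversions (u : set (nat -> 'End(affine_space))) :
    set affine_space :=
  \bigcup_(s in u) expression_inversions s.

Definition all_words :
    set (set (nat -> 'End(affine_space)) + 'End(affine_space)) :=
  inl @` infinite_words `|` inr @` affine_weyl.

Definition all_word_inversions
    (u : set (nat -> 'End(affine_space)) + 'End(affine_space)) :
    set affine_space :=
  match u with
  | inl u => word_inversions u
  | inr x => inversions x
  end.

End AffineRootSystems.

(* Main.v *)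
(**
  Fix the linear functional on V' that is 1 on every affine simple root; a root
  is positive iff its value is positive, and rho lies in Phi_x iff the functional
  is negative at x^-1(rho).

  Let Q be a convex cone containing one root of each pair +-rho and
  missing only finitely many positive roots.  Reflecting repeatedly in simple
  roots outside Q yields x with x(positive roots) inside Q.

  Let l be the functional on V that is 0 on L and 1 on Pi \ L, so
  that Phi^+_{L,0} = {l > 0}.  Then rho lies in w.hat(Phi^+_{L,0}) iff
  sigma = w^-1(rho) satisfies l(sigma) > 0, or l(sigma) = 0 and sigma < 0.  For
  M large, the cones {height - M l > 0} moved by w cut out inversion sets that
  are contained in the orbit set and exhaust it; joining the corresponding
  chambers by reduced galleries gives an infinite reduced expression.

  Conversely, for the initial segments x_k of an infinite reduced expression,
  the heights of x_k^-1(alpha), alpha in Phi, tend to -oo, stay bounded, or tend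
  to +oo.  The bounded roots are settled at a finite stage K, and an element u
  of the finite Weyl group makes the roots tending to -oo standard; the union
  of the inversion sets is then the orbit set of x_K u.
*)

Require Import Defs.
From mathcomp Require Import all_boot all_order all_algebra.
From mathcomp Require Import boolp classical_sets functions cardinality fsbigop.
From mathcomp Require Import reals zify ring lra.

Set Implicit Arguments.
Unset Strict Implicit.
Unset Printing Implicit Defensive.

Import Order.TTheory GRing.Theory Num.Theory.

Local Open Scope classical_set_scope.
Local Open Scope ring_scope.

(** * Archimedean bounds *)

Lemma ex_nat_gt (R : realType) (x : R) : exists n : nat, x < n%:R.
Proof.
exists (Num.bound `|x|); rewrite (le_lt_trans (ler_norm _)) //.
by rewrite archi_boundP.
Qed.

Lemma seq_bounded (R : realType) (T : eqType) (s : seq T) (g : T -> R) :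
  exists N : nat, forall x, x \in s -> g x < N%:R.
Proof.
elim: s => [|y s [N IH]]; first by exists 0%N.
have [M hM] := ex_nat_gt (g y); exists (N + M)%N => x.
rewrite inE natrD => /predU1P[->|/IH xN].
  by apply: (lt_le_trans hM); rewrite lerDr.
by apply: (lt_le_trans xN); rewrite lerDl.
Qed.

Section RootSystem.
Context (R : realType) (V : vectType R) (dot : {dot V for idfun}).
Context (Phi Pi : set V) (gamma : V).
Hypothesis Phi_root : crystallographic_root_system dot Phi.
Hypothesis Pi_simple : simple_system Phi Pi.
Hypothesis gamma_highest : highest_root Phi Pi gamma.

Local Notation Pis := (finmap.enum_fset (fset_set Pi)).

(** * The inner product and coordinates in the simple roots *)

Lemma dotC u v : dot u v = dot v u.
Proof. by have := @hermC R false idfun V dot u v; rewrite expr0 mul1r. Qed.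

Lemma dotDl u v w : dot (u + v) w = dot u w + dot v w.
Proof. by rewrite linearDl. Qed.

Lemma dotZl c u w : dot (c *: u) w = c * dot u w.
Proof. by rewrite linearZl_LR. Qed.

Lemma dotNl u w : dot (- u) w = - dot u w.
Proof. by rewrite -scaleN1r dotZl mulN1r. Qed.

Lemma dotNr u w : dot u (- w) = - dot u w.
Proof. by rewrite dotC dotNl dotC. Qed.

Lemma dotDr u v w : dot u (v + w) = dot u v + dot u w.
Proof. by rewrite dotC dotDl !(dotC u). Qed.

Lemma dotZr c u w : dot u (c *: w) = c * dot u w.
Proof. by rewrite dotC dotZl dotC. Qed.

Lemma finite_Pi : finite_set Pi.
Proof. by case: Pi_simple => /sub_finite_set h _ _;
  exact: h (roots_finite Phi_root). Qed.

Lemma mem_Pis p : p \in Pis <-> Pi p.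
Proof. by rewrite in_fset_set ?inE //; exact: finite_Pi. Qed.

(** The linear functional with value [k p] at each simple root [p]. Height, single coordinates and
    the weights off [L] are all instances. *)
Definition coef (k : V -> R) (v : V) : R :=
  \sum_(i < size Pis) k Pis`_i * coord (in_tuple Pis) i v.

Lemma coefD k u v : coef k (u + v) = coef k u + coef k v.
Proof.
by rewrite /coef -big_split /=; apply: eq_bigr => i _; rewrite linearD mulrDr.
Qed.

Lemma coefZ k c u : coef k (c *: u) = c * coef k u.
Proof.
by rewrite /coef mulr_sumr; apply: eq_bigr => i _; rewrite linearZ /= mulrCA.
Qed.

Lemma coefN k u : coef k (- u) = - coef k u.
Proof. by rewrite -scaleN1r coefZ mulN1r. Qed.

Lemma coefB k u v : coef k (u - v) = coef k u - coef k v.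
Proof. by rewrite coefD coefN. Qed.

Lemma coef0 k : coef k 0 = 0.
Proof. by rewrite -(scale0r 0) coefZ mul0r. Qed.

Lemma coef_sum k (c : V -> R) (s : seq V) :
  coef k (\sum_(p <- s) c p *: p) = \sum_(p <- s) c p * coef k p.
Proof.
elim: s => [|p s IH]; first by rewrite !big_nil coef0.
by rewrite !big_cons coefD coefZ IH.
Qed.

Lemma coef_simple k p : Pi p -> coef k p = k p.
Proof.
move=> /mem_Pis pin; have freeP : free Pis by case: Pi_simple.
have ip : (index p Pis < size Pis)%N by rewrite index_mem.
have coordp i : coord (in_tuple Pis) i p = (i == Ordinal ip)%:R.
  by rewrite -{1}(nth_index 0 pin) (@coord_free _ _ _ (in_tuple Pis) (Ordinal ip)) // eq_sym.
rewrite /coef (bigD1 (Ordinal ip)) //= big1 => [|i ine].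
  by rewrite coordp eqxx mulr1 addr0 nth_index.
by rewrite coordp (negbTE ine) mulr0.
Qed.

Lemma coneP v : nonneg_cone Pi v -> exists c : V -> R,
  [/\ forall p, 0 <= c p, v = \sum_(p <- Pis) c p *: p &
      forall k, coef k v = \sum_(p <- Pis) c p * k p].
Proof.
case=> c c0; rewrite fsbig_finite; last exact: finite_Pi. move=> ->.
exists (fun p => if p \in Pis then c p else 0); split.
- by move=> p; case: ifP => // /mem_Pis; exact: c0.
- by rewrite big_seq [RHS]big_seq; apply: eq_bigr => p ->.
- move=> k; rewrite coef_sum big_seq [RHS]big_seq; apply: eq_bigr => p pin.
  by rewrite pin coef_simple //; exact/mem_Pis.
Qed.

(** * Heights of finite roots *)

Definition height : V -> R := coef (fun=> 1).

Lemma root_neq0 a : Phi a -> a != 0.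
Proof. by move=> Pa; apply/eqP => a0; case: Phi_root => _ _ + _ _ _;
  rewrite -a0. Qed.

Lemma root_dot_gt0 a : Phi a -> 0 < dot a a.
Proof. by move=> /root_neq0; exact: neq0_dnorm_gt0. Qed.

Lemma rootN a : Phi a -> Phi (- a).
Proof.
move=> Pa; have := roots_reflection Phi_root Pa Pa.
rewrite /reflection mulfK ?gt_eqF ?root_dot_gt0 // scaler_nat mulr2n opprD addrA.
by rewrite subrr sub0r.
Qed.

Lemma cone_height v : nonneg_cone Pi v -> 0 <= height v.
Proof.
by rewrite /height; case/coneP => c [c0 _ ->]; apply: sumr_ge0 => p _; rewrite mulr1.
Qed.

Lemma cone_height_gt0 v : nonneg_cone Pi v -> v != 0 -> 0 < height v.
Proof.
move=> cv; rewrite lt0r (cone_height cv) andbT; apply: contra => /eqP.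
rewrite /height; have [c [c0 -> ->]] := coneP cv.
move/eqP; rewrite psumr_eq0 => [|p _]; last by rewrite mulr1.
move/allP => z; rewrite big_seq big1 // => p /z /eqP.
by rewrite mulr1 => ->; rewrite scale0r.
Qed.

Lemma root_cone a : Phi a -> nonneg_cone Pi a <-> 0 < height a.
Proof.
move=> Pa; split=> [/cone_height_gt0|h]; first by apply; exact: root_neq0.
case: Pi_simple => _ _ /(_ a Pa) [] // /cone_height.
by rewrite /height coefN oppr_ge0 leNgt h.
Qed.

Lemma height_root_neq0 a : Phi a -> height a != 0.
Proof.
move=> Pa; case: Pi_simple => _ _ /(_ a Pa) [] /cone_height_gt0.
  by move/(_ (root_neq0 Pa)) => /gt_eqF ->.
by rewrite oppr_eq0 /height coefN oppr_gt0 => /(_ (root_neq0 Pa)) /lt_eqF ->.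
Qed.

Lemma positive_rootE a : positive_roots Phi Pi a <-> Phi a /\ 0 < height a.
Proof. by split=> -[Pa] /(root_cone Pa). Qed.

Lemma height_simple p : Pi p -> height p = 1.
Proof. exact: coef_simple. Qed.

Lemma Pi_Phi p : Pi p -> Phi p.
Proof. by case: Pi_simple => + _ _; apply. Qed.

Lemma gamma_root : Phi gamma. Proof. by case: gamma_highest. Qed.

Lemma height_le a : Phi a -> height a <= height gamma.
Proof.
move=> Pa; rewrite -subr_ge0 -[_ - _]coefB; apply: cone_height.
by case: gamma_highest => _; apply.
Qed.

Lemma height_ge a : Phi a -> - height gamma <= height a.
Proof. by move=> /rootN /height_le; rewrite /height coefN lerNl. Qed.

Lemma height_gamma_gt0 : 0 < height gamma.
Proof.
have := height_ge gamma_root; have := height_root_neq0 gamma_root.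
by rewrite lt0r => -> /=; lra.
Qed.

(** * Affine roots, their heights and reflections *)

Local Notation AV := (affine_space V).

(** The coefficient [1 + height gamma] of delta is the one that gives delta - gamma the value 1. *)
Definition aheight (v : AV) : R := height v.1 + v.2 * (1 + height gamma).

Lemma aheightD u v : aheight (u + v) = aheight u + aheight v.
Proof. by rewrite /aheight /height /= coefD; ring. Qed.

Lemma aheightZ c u : aheight (c *: u) = c * aheight u.
Proof. by rewrite /aheight /height /= coefZ -[c *: _]/(c * _); ring. Qed.

Lemma aheightN u : aheight (- u) = - aheight u.
Proof. by rewrite -scaleN1r aheightZ mulN1r. Qed.

Lemma aheightB u v : aheight (u - v) = aheight u - aheight v.
Proof. by rewrite aheightD aheightN. Qed.

Definition affine_root (rho : AV) : Prop := Phi rho.1 /\ rho.2 \is a Num.int.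

Lemma affine_rootN rho : affine_root rho -> affine_root (- rho).
Proof. by case=> r1 r2; split; [exact: rootN|rewrite rpredN]. Qed.

Lemma int_cmp (x : R) : x \is a Num.int -> [\/ x <= -1, x = 0 | 1 <= x].
Proof.
move=> /intrP[m ->]; case: (ltgtP m 0) => h.
- by apply: Or31; have : (m%:~R <= (-1)%:~R :> R) by rewrite ler_int; lia.
- by apply: Or33; have : (1%:~R <= m%:~R :> R) by rewrite ler_int; lia.
- by apply: Or32; rewrite h.
Qed.

Local Notation s_ a := (affine_reflection dot a).

Definition cartan (b a : V) : R := 2 * dot b a / dot a a.

Lemma refl_fst (a v : AV) : (s_ a v).1 = reflection dot a.1 v.1.
Proof. by rewrite affine_reflectionE. Qed.

Lemma refl_snd (a v : AV) : (s_ a v).2 = v.2 - cartan v.1 a.1 * a.2.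
Proof. by rewrite affine_reflectionE. Qed.

Lemma affine_root_refl a v : affine_root a -> affine_root v -> affine_root (s_ a v).
Proof.
move=> [Pa ia] [Pv iv]; split; first by rewrite refl_fst; exact: roots_reflection.
by rewrite refl_snd; apply: rpredB => //; apply: rpredM => //;
  exact: (roots_integral Phi_root Pa Pv).
Qed.

Lemma refl_self (a : AV) : affine_root a -> s_ a a = - a.
Proof.
move=> [Pa _]; rewrite affine_reflectionE mulfK ?gt_eqF ?root_dot_gt0 //.
by rewrite scaler_nat mulr2n opprD addrA subrr sub0r.
Qed.

Lemma reflK (a : AV) : affine_root a -> involutive (s_ a).
Proof.
move=> ra v; rewrite [s_ a v]affine_reflectionE linearB linearZ /= refl_self //.
by rewrite affine_reflectionE scalerN opprK subrK.
Qed.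

Local Notation simple := (affine_simple_roots Pi gamma).

Lemma simple_root a : simple a -> affine_root a.
Proof.
by move=> [[p /Pi_Phi Pp <-]| ->]; split => //=; apply/rootN/gamma_root.
Qed.

Lemma simple_aheight a : simple a -> aheight a = 1.
Proof.
case=> [[p Pp <-]|->]; rewrite /aheight /=; first by rewrite height_simple // mul0r addr0.
by rewrite mul1r /height coefN; ring.
Qed.

(** One level adds [1 + height gamma], more than a finite height can take away. Hence positivity is
    lexicographic: first the level, then the finite height. *)
Lemma aheight_level_pos r : affine_root r -> 1 <= r.2 -> 0 < aheight r.
Proof.
move=> [Pr _] r2; rewrite /aheight; have := height_ge Pr; have := height_gamma_gt0.
by nra.
Qed.

Lemma aheight_pos_level r : affine_root r -> 0 < aheight r ->
  (r.2 = 0 /\ 0 < height r.1) \/ 1 <= r.2.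
Proof.
move=> rr h; case: (int_cmp (proj2 rr)) => [r2|r2|]; last by right.
- have := aheight_level_pos (affine_rootN rr); rewrite aheightN /= => h'.
  by have := h' ltac:(lra); lra.
- by left; move: h; rewrite /aheight r2 mul0r addr0.
Qed.

Lemma aheight_neq0 r : affine_root r -> aheight r != 0.
Proof.
move=> rr; case: (int_cmp (proj2 rr)) => [r2|r2|r2].
- have := aheight_level_pos (affine_rootN rr); rewrite aheightN /= => h'.
  by rewrite lt_eqF //; have := h' ltac:(lra); lra.
- by rewrite /aheight r2 mul0r addr0 height_root_neq0 //; case: rr.
- by rewrite gt_eqF // aheight_level_pos.
Qed.

(** The reflection changes only the coordinate at [p]. If the image were negative, the other
    coordinates of [a] would vanish, and a root that is a nonnegative multiple of [p] is [p]
    itself. *)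
Lemma simple_reflection_pos p a : Pi p -> Phi a -> 0 < height a -> a <> p ->
  0 < height (reflection dot p a).
Proof.
move=> Pp Pa ha ap; have Pra := roots_reflection Phi_root (Pi_Phi Pp) Pa.
have := height_root_neq0 Pra; case: ltgtP => // hr _.
have [c [c0 ca cE]] := coneP (proj2 (root_cone Pa) ha).
have Nra : nonneg_cone Pi (- reflection dot p a).
  by apply/(root_cone (rootN Pra)); rewrite /height coefN oppr_gt0.
have [c' [c'0 _ c'E]] := coneP Nra.
have cq0 q : q \in Pis -> q != p -> c q = 0.
  move=> qin qp; have delta (d : V -> R) : \sum_(r <- Pis) d r * (r == q)%:R = d q.
    rewrite (bigD1_seq q) //= ?finmap.fset_uniq // eqxx mulr1 big1 ?addr0 // => r /negbTE ->.
    by rewrite mulr0.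
  have := c'E (fun r => (r == q)%:R); rewrite delta.
  rewrite coefN coefB coefZ (coef_simple _ Pp) eq_sym (negbTE qp) mulr0 subr0 cE delta.
  by have := c0 q; have := c'0 q; lra.
have apE : a = c p *: p.
  rewrite {1}ca (bigD1_seq p) ?finmap.fset_uniq //=; last exact/mem_Pis.
  rewrite big_seq_cond big1 ?addr0 // => q /andP[qin qp].
  by rewrite cq0 ?scale0r.
have [] := roots_reduced Phi_root (Pi_Phi Pp) (c := c p); first by rewrite -apE.
  by move=> c1; case: ap; rewrite apE c1 scale1r.
by have := c0 p => + c1; rewrite c1; lra.
Qed.

Lemma cartan_int a b : Phi a -> Phi b -> cartan b a \is a Num.int.
Proof. by move=> Pa Pb; exact: (roots_integral Phi_root Pa Pb). Qed.

Lemma cartanN a b : cartan (- b) a = - cartan b a.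
Proof. by rewrite /cartan dotNl mulrN mulNr. Qed.

(* The highest root dominates both [a] and [- s_gamma a = k gamma - a], where
   [k = cartan a gamma]; comparing heights gives k <= 2, with equality only for
   [a = gamma]. *)
Lemma cartan_highest a : Phi a -> 2 <= cartan a gamma -> a = gamma.
Proof.
move=> Pa k2; have Pr := rootN (roots_reflection Phi_root gamma_root Pa).
have := height_le Pr; rewrite /height coefN coefB coefZ -/(cartan a gamma) => h.
have := height_gamma_gt0; rewrite /height => g0.
apply/eqP; rewrite eq_sym -subr_eq0; apply: contraT.
move=> /(cone_height_gt0 (proj2 gamma_highest _ Pa)).
by rewrite /height coefB; nra.
Qed.

Lemma cartan_self a : Phi a -> cartan a a = 2.
Proof. by move=> Pa; rewrite /cartan mulfK // gt_eqF ?root_dot_gt0. Qed.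

(** A root of [Pi] preserves the level, and level 0 is the finite case. For delta - gamma the level
    changes by [k = cartan r.1 gamma], so only [k < 0] needs care, and there the highest root limits
    the possibilities. *)
Lemma simple_reflection_aheight a r : simple a -> affine_root r ->
  0 < aheight r -> r <> a -> 0 < aheight (s_ a r).
Proof.
move=> sa rr hr ra; have rs := affine_root_refl (simple_root sa) rr.
case: sa => [[p Pp ap]|at_] in ra rs *.
  rewrite -ap in ra rs *; have [[r2 hr1]|r2] := aheight_pos_level rr hr; last first.
    by apply: aheight_level_pos => //; rewrite refl_snd /= mulr0 subr0.
  rewrite /aheight refl_fst refl_snd /= mulr0 subr0 r2 mul0r addr0.
  apply: simple_reflection_pos => //; first by case: rr.
  by move=> r1p; apply: ra; rewrite -r1p -r2; case: (r).
have Pr := proj1 rr; have Pg := gamma_root; have hg := height_gamma_gt0.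
have s1 : (s_ a r).1 = r.1 - cartan r.1 gamma *: gamma.
  by rewrite refl_fst at_ /reflection /= !dotNr dotNl !opprK mulrN mulNr scalerN scaleNr opprK.
have s2 : (s_ a r).2 = r.2 + cartan r.1 gamma.
  by rewrite refl_snd at_ /cartan /= !dotNr dotNl !opprK mulrN mulNr mulr1 opprK.
have := aheight_pos_level rr hr; set k := cartan _ _ in s1 s2 => r2.
have r20 : 0 <= r.2 by case: r2 => [[->]|]; lra.
have kint : k \is a Num.int := cartan_int Pg Pr.
have [k1|k0|k1] := int_cmp kint.
(* If [k <= -2], then [r] is n delta - gamma: n = 0 is not positive, n = 1 is [a], and for n >= 2
   the image is gamma + (n - 2) delta. If [k = -1], the new finite part [r.1 + gamma] has positive
   height, and at level 0 it would exceed the highest root. *)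
- have [k2|k2|k2] := int_cmp (rpredD kint (rpred1 _)); last by lra.
    have rg : - r.1 = gamma by apply: cartan_highest; [exact: rootN|rewrite cartanN -/k; lra].
    have kE : k = -2 by rewrite /k -[r.1]opprK rg cartanN cartan_self.
    rewrite kE in s1 s2.
    case: r2 => [[_]|r2]; first by rewrite -[r.1]opprK rg /height coefN -/(height _); lra.
    have [r3|r3|r3] := int_cmp (rpredB (proj2 rr) (rpred1 _)); first by lra.
      by case: ra; rewrite at_ -rg opprK; case: (r) r3 => /= ? ? ?; congr pair; lra.
    have sr1 : (s_ a r).1 = gamma.
      by rewrite s1 -[r.1]opprK rg scaleNr opprK scaler_nat mulr2n addKr.
    by rewrite /aheight sr1 s2; nra.
  have kE : k = -1 by lra.
  rewrite kE in s1 s2; case: r2 => [[_ hr1]|r2].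
    have := height_le (proj1 rs); rewrite s1 /height coefB coefZ.
    by move: hg hr1; rewrite /height; lra.
  have := height_root_neq0 (proj1 rs); have := height_ge Pr.
  rewrite /aheight s1 s2 /height coefB coefZ -!/(height _) => h1 h2.
  by have : 0 < height r.1 - -1 * height gamma; [rewrite lt0r h2 /=; lra|nra].
- suff -> : s_ a r = r by [].
  move: s1 s2; rewrite k0 scale0r subr0 addr0.
  by move=> e1 e2; rewrite [LHS]surjective_pairing e1 e2 -surjective_pairing.
- by apply: aheight_level_pos => //; rewrite s2; lra.
Qed.

(** * Positive affine roots and descent by simple reflections *)

Local Notation hat_Phi := (hat Phi Pi Phi).

Lemma hatE (G : set V) r : G `<=` Phi ->
  hat Phi Pi G r <-> [/\ affine_root r, G r.1 & 0 < aheight r].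
Proof.
move=> GP; split.
  case=> a [n [Ga [[/positive_rootE[Pa ha] ->]|[/positive_rootE[Pa ha] ->]]]]; split => //=.
  - by split => /=; [exact: GP|rewrite natr_int].
  - rewrite /aheight /=; have := height_gamma_gt0; have : 0 <= n%:R :> R by [].
    by move: ha; nra.
  - by split => /=; [exact: GP|rewrite natr_int].
  - apply: aheight_level_pos => //=; last by rewrite -natr1 lerDr.
    by split => /=; [exact: GP|rewrite natr_int].
case=> rr Gr hr; have := aheight_pos_level rr hr; case: rr => Pr /intrP[m r2].
case: r => r1 r2' /= in Pr r2 hr Gr *; rewrite {}r2 in hr *.
case=> [[m0 h1]|m1].
  by exists r1, 0; split => //; left; split; [exact/positive_rootE|rewrite m0].
have m1' : (1 <= m)%R by rewrite -(ler_int R).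
case: m m1 m1' hr => // -[//|n] _ _ hr.
have := height_root_neq0 Pr; case: ltgtP => // h1 _.
  exists r1, n; split => //; right; split => //; apply/positive_rootE.
  by split; [exact: rootN|rewrite /height coefN oppr_gt0].
by exists r1, n.+1; split => //; left; split => //; apply/positive_rootE.
Qed.

Lemma hat_PhiE r : hat_Phi r <-> affine_root r /\ 0 < aheight r.
Proof. by rewrite hatE //; split=> [[]|[]] // [? ?] ?; split. Qed.

Local Notation W := (affine_weyl dot Phi Pi).

Lemma simple_hat a : simple a -> hat_Phi a.
Proof.
by move=> sa; apply/hat_PhiE; rewrite simple_aheight //; split => //;
  exact: simple_root.
Qed.

Lemma dot_suml (c : V -> R) (s : seq V) w :
  dot (\sum_(p <- s) c p *: p) w = \sum_(p <- s) c p * dot p w.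
Proof.
elim: s => [|p s IH]; first by rewrite !big_nil linear0l.
by rewrite !big_cons dotDl dotZl IH.
Qed.

(** Otherwise [r.1] pairs nonpositively with the cone of [Pi] and nonnegatively with [gamma]. That
    cone contains [r.1] at level 0 and [gamma + r.1] in any case; either way [dot r.1 r.1 <= 0]. *)
Lemma simple_acute r : affine_root r -> 0 < aheight r ->
  exists2 a, simple a & 0 < dot r.1 a.1.
Proof.
move=> rr hr; apply: contrapT => nex.
have neg a : simple a -> dot r.1 a.1 <= 0.
  by move=> sa; rewrite leNgt; apply/negP => h; apply: nex; exists a.
have sum_le0 v : nonneg_cone Pi v -> dot v r.1 <= 0.
  case/coneP => c [c0 -> _]; rewrite dot_suml big_seq; apply: sumr_le0 => p /mem_Pis Pp.
  by rewrite dotC mulr_ge0_le0 //; apply: (neg (p, 0)); left; exists p.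
have := root_dot_gt0 (proj1 rr); apply/negP; rewrite -leNgt.
case: (aheight_pos_level rr hr) => [[_ /(root_cone (proj1 rr)) /sum_le0 //]|_].
have := sum_le0 _ (proj2 gamma_highest _ (rootN (proj1 rr))); rewrite opprK dotDl.
by have := neg (- gamma, 1) ltac:(right => //); rewrite /= dotNr dotC; lra.
Qed.

(** An acute simple root has Cartan integer at least 1, and each multiple of it subtracted lowers
    the height by 1. *)
Lemma simple_descent r : affine_root r -> 0 < aheight r -> ~ simple r ->
  exists a, [/\ simple a, affine_root (s_ a r), 0 < aheight (s_ a r) &
                aheight (s_ a r) <= aheight r - 1].
Proof.
move=> rr hr nsr; have [a sa d] := simple_acute rr hr.
have ra := simple_root sa; exists a; split => //; first exact: affine_root_refl.
  by apply: simple_reflection_aheight => // ra'; apply: nsr; rewrite ra'.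
rewrite affine_reflectionE aheightB aheightZ (simple_aheight sa) mulr1 lerD2l lerN2.
have [k|k|//] := int_cmp (cartan_int (proj1 ra) (proj1 rr)).
  have : 0 < cartan r.1 a.1 by rewrite /cartan divr_gt0 ?mulr_gt0 ?root_dot_gt0 //; case: ra.
  by lra.
have : 0 < cartan r.1 a.1 by rewrite /cartan divr_gt0 ?mulr_gt0 ?root_dot_gt0 //;
  case: ra.
by lra.
Qed.

(** * Weyl group elements as isometries *)

Definition delta : AV := (0, 1).

Lemma affine_splitE (v : AV) : v = (v.1, 0) + v.2 *: delta.
Proof.
case: v => a c; rewrite /delta; congr pair; first by rewrite /= scaler0 addr0.
by rewrite /= add0r -[_ *: _]/(c * 1) mulr1.
Qed.

Lemma aheight_delta : 0 < aheight delta.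
Proof. by rewrite /aheight /= /height coef0; have := height_gamma_gt0;
  rewrite /height; lra. Qed.

Lemma dot_reflection a u v : dot a a != 0 ->
  dot (reflection dot a u) (reflection dot a v) = dot u v.
Proof.
move=> a0; rewrite /reflection !(dotDl, dotDr, dotNl, dotNr, dotZl, dotZr) (dotC a).
by field.
Qed.

Definition affine_isometry (x : 'End(AV)) : Prop :=
  [/\ lker x == 0%VS,
      forall r, affine_root r -> affine_root (x r) /\ affine_root (x^-1%VF r),
      x delta = delta &
      forall u v : AV, dot (x u).1 (x v).1 = dot u.1 v.1].

Lemma endN (x : 'End(AV)) v : x (- v) = - x v.
Proof. by rewrite linearN. Qed.

Lemma endD (x : 'End(AV)) u v : x (u + v) = x u + x v.
Proof. by rewrite linearD. Qed.

Lemma endZ (x : 'End(AV)) c v : x (c *: v) = c *: x v.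
Proof. by rewrite linearZ. Qed.

(** [x^-1] is defined for every endomorphism, so it has to be identified: a right inverse [y] is
    injective, hence bijective in finite dimension, and [x] is its inverse. *)
Lemma inv_lfunE (x y : 'End(AV)) : (x \o y = \1)%VF -> (x^-1 = y)%VF.
Proof.
move=> xy; have xyE v : x (y v) = v by rewrite -comp_lfunE xy id_lfunE.
have y0 : lker y == 0%VS.
  by apply/lker0P => u v e; rewrite -(xyE u) e xyE.
have yx : (y^-1 = x)%VF.
  apply/lfunP => v;
    rewrite -[X in _ X = _](lker0_lfunVK y0) -[v in RHS](lker0_lfunVK y0) xyE.
  by rewrite (lker0_lfunK y0).
have x0 : lker x == 0%VS.
  apply/lker0P => u v; rewrite -yx => e.
  by rewrite -(lker0_lfunVK y0 u) e lker0_lfunVK.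
by apply/lfunP => v; rewrite -{1}(xyE v) lker0_lfunK.
Qed.

Lemma refl_sqr a : affine_root a -> (s_ a \o s_ a = \1)%VF.
Proof. by move=> ra; apply/lfunP => v; rewrite comp_lfunE id_lfunE reflK. Qed.

Lemma refl_inv a : affine_root a -> ((s_ a)^-1 = s_ a)%VF.
Proof. by move=> /refl_sqr/inv_lfunE. Qed.

Lemma weyl_isometry x : W x -> affine_isometry x.
Proof.
move: x; apply: smallest_sub => [|_ [a /hat_PhiE[ra _] <-]]; last first.
  split; first by apply/lker0P => u v e; rewrite -(reflK ra u) e reflK.
  - by move=> r rr; rewrite refl_inv //; split; exact: affine_root_refl.
  - by rewrite affine_reflectionE /= linear0l mulr0 mul0r scale0r subr0.
  - by move=> u v; rewrite !refl_fst dot_reflection // gt_eqF // root_dot_gt0 //;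
    case: ra.
have lker_inv (x : 'End(AV)) : lker x == 0%VS -> lker x^-1%VF == 0%VS.
  by move=> x0; apply/lker0P => u v e; rewrite -(lker0_lfunVK x0 u) e lker0_lfunVK.
have inv_inv (x : 'End(AV)) : lker x == 0%VS -> (x^-1^-1 = x)%VF.
  by move=> x0; apply: inv_lfunE; exact: lker0_compVf.
split.
- split; first by apply/lker0P => u v; rewrite !id_lfunE.
  + by move=> r rr; rewrite (_ : (\1^-1 = \1)%VF) ?id_lfunE //; apply: inv_lfunE;
    rewrite comp_lfun1l.
  + by rewrite id_lfunE.
  + by move=> u v; rewrite !id_lfunE.
- move=> x y [x0 xr xd xf] [y0 yr yd yf]; split.
  + by apply/lker0P => u v; rewrite !comp_lfunE => /(lker0P x0)/(lker0P y0).
  + have -> : ((x \o y)^-1 = y^-1 \o x^-1)%VF.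
      apply: inv_lfunE;
        rewrite -comp_lfunA (comp_lfunA y) lker0_compfV // comp_lfun1l.
      by rewrite lker0_compfV.
    move=> r rr; rewrite !comp_lfunE; split.
      by apply: (xr _ _).1; apply: (yr _ _).1.
    by apply: (yr _ _).2; apply: (xr _ _).2.
  + by rewrite comp_lfunE yd xd.
  + by move=> u v; rewrite !comp_lfunE xf yf.
- move=> x [x0 xr xd xf]; split; first exact: lker_inv.
  + by move=> r /xr[]; rewrite inv_inv.
  + by rewrite -{1}xd lker0_lfunK.
  + by move=> u v; rewrite -xf !lker0_lfunVK.
Qed.

Section WeylElement.
Context (x : 'End(AV)) (Wx : W x).

Lemma weylK : cancel x x^-1%VF.
Proof. by have [x0 _ _ _] := weyl_isometry Wx; exact: lker0_lfunK. Qed.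

Lemma weylVK : cancel x^-1%VF x.
Proof. by have [x0 _ _ _] := weyl_isometry Wx; exact: lker0_lfunVK. Qed.

Lemma weyl_root r : affine_root r -> affine_root (x r).
Proof. by have [_ h _ _] := weyl_isometry Wx; case/h. Qed.

Lemma weylV_root r : affine_root r -> affine_root (x^-1%VF r).
Proof. by have [_ h _ _] := weyl_isometry Wx; case/h. Qed.

Lemma weyl_delta : x delta = delta.
Proof. by have [] := weyl_isometry Wx. Qed.

Lemma weylV_delta : x^-1%VF delta = delta.
Proof. by rewrite -{1}weyl_delta weylK. Qed.

Lemma weyl_refl a : (x \o s_ a = s_ (x a) \o x)%VF.
Proof.
have [_ _ _ xf] := weyl_isometry Wx.
by apply/lfunP => v; rewrite !comp_lfunE !affine_reflectionE !xf linearB linearZ.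
Qed.

Lemma inversionsE r : inversions Phi Pi x r <->
  [/\ affine_root r, 0 < aheight r & aheight (x^-1%VF r) < 0].
Proof.
split=> [[/hat_PhiE[rr hr] [r' /hat_PhiE[rr' hr'] e]]|[rr hr hxr]].
  by split => //; rewrite -e aheightN oppr_lt0.
split; first exact/hat_PhiE.
exists (- x^-1%VF r); rewrite ?opprK //; apply/hat_PhiE; rewrite aheightN oppr_gt0.
by split => //; apply: affine_rootN; exact: weylV_root.
Qed.

End WeylElement.

(** * Words in the simple reflections *)

Lemma weyl_subgroup : is_subgroup W.
Proof.
split=> [G [[G1 _ _] _] //|x y Wx Wy G GG|x Wx G GG].
  by case: (GG) => -[_ GM _] _; apply: GM; [exact: Wx|exact: Wy].
by case: (GG) => -[_ _ GV] _; apply: GV; exact: Wx.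
Qed.

Lemma weyl1 : W \1%VF. Proof. by case: weyl_subgroup. Qed.

Lemma weylM x y : W x -> W y -> W (x \o y)%VF.
Proof. by case: weyl_subgroup => _ + _; apply. Qed.

Lemma weylV x : W x -> W x^-1%VF.
Proof. by case: weyl_subgroup => _ _; apply. Qed.

Lemma weyl_simple a : simple a -> W (s_ a).
Proof. by move=> sa G [_]; apply; exists a => //; exact: simple_hat. Qed.

Lemma weyl_invM x y : W x -> W y -> ((x \o y)^-1 = y^-1 \o x^-1)%VF.
Proof.
move=> Wx Wy; apply: inv_lfunE; apply/lfunP => v; rewrite !comp_lfunE id_lfunE.
by rewrite !weylVK.
Qed.

Local Notation simple_word := (simple_word dot Pi gamma).

Lemma simple_word_cons x s :
  simple_word (x :: s) <-> (exists2 a, simple a & x = s_ a) /\ simple_word s.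
Proof.
split=> [h|[[a sa ->] h] y].
  split; last by move=> y ys; apply: h; rewrite inE ys orbT.
  by have [a sa <-] := h x (mem_head _ _); exists a.
by rewrite inE => /predU1P[->|/h //]; exists a.
Qed.

Lemma simple_word_cat s t : simple_word (s ++ t) <-> simple_word s /\ simple_word t.
Proof.
elim: s => [|x s IH] /=; first by split=> [h|[]].
by rewrite !simple_word_cons IH; tauto.
Qed.

Lemma simple_word_rcons s x :
  simple_word (rcons s x) <-> simple_word s /\ exists2 a, simple a & x = s_ a.
Proof.
rewrite -cats1 simple_word_cat simple_word_cons; by split=> [[? []]|[]] //.
Qed.

Lemma word_prod_cat (s t : seq 'End(AV)) :
  word_prod (s ++ t) = (word_prod s \o word_prod t)%VF.
Proof. by elim: s => [|x s IH] /=; rewrite ?comp_lfun1l // IH comp_lfunA. Qed.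

Lemma word_prod_rcons (s : seq 'End(AV)) x :
  word_prod (rcons s x) = (word_prod s \o x)%VF.
Proof. by rewrite -cats1 word_prod_cat /= comp_lfun1r. Qed.

Lemma simple_word_weyl s : simple_word s -> W (word_prod s).
Proof.
elim: s => [_|x s IH]; first exact: weyl1.
by case/simple_word_cons => -[a sa ->] /IH ?; apply: weylM => //; exact: weyl_simple.
Qed.

(** Induction on the height: a simple descent lowers [r] to [s_ a r], and the reflection in [r] is
    conjugate by [s_ a] to the reflection in that lower root. *)
Lemma hat_reflection_word r : affine_root r -> 0 < aheight r ->
  exists2 s, simple_word s & s_ r = word_prod s.
Proof.
have [n] := ex_nat_gt (aheight r).
elim: n r => [|n IH] r hn rr hr; first by move: (lt_trans hr hn); rewrite ltxx.
have [sr|nsr] := pselect (simple r).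
  by exists [:: s_ r]; rewrite /= ?comp_lfun1r //; apply/simple_word_cons; split => //; exists r.
have [a [sa rs hs hle]] := simple_descent rr hr nsr.
have [|s ss e] := IH _ _ rs hs; first by move: hn; rewrite -natr1; lra.
exists (s_ a :: rcons s (s_ a)).
  by apply/simple_word_cons; split; [exists a|apply/simple_word_rcons; split => //; exists a].
rewrite /= word_prod_rcons -e; have ra := simple_root sa.
rewrite comp_lfunA (weyl_refl (weyl_simple sa)) reflK //.
by rewrite -comp_lfunA refl_sqr // comp_lfun1r.
Qed.

Lemma weyl_word x : W x -> exists2 s, simple_word s & x = word_prod s.
Proof.
move: x; suff: W `<=` [set x | exists2 s, simple_word s & x = word_prod s] by apply.
apply: smallest_sub; last first.
  by move=> _ [r /hat_PhiE[rr hr] <-]; exact: hat_reflection_word.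
split=> [|_ _ [s ss ->] [t st ->]|_ [s ss ->]].
- by exists [::].
- by exists (s ++ t); [exact/simple_word_cat|rewrite word_prod_cat].
- exists (rev s); first by move=> y; rewrite mem_rev; exact: ss.
  elim: s ss => [|y s IH]; first by move=> _; apply: inv_lfunE; rewrite comp_lfun1l.
  case/simple_word_cons => -[a sa ->] ss; rewrite rev_cons word_prod_rcons -IH //=.
  rewrite weyl_invM ?refl_inv //; [exact: simple_root|exact: weyl_simple|exact: simple_word_weyl].
Qed.

Lemma aheight_refl a r : simple a -> aheight (s_ a r) = aheight r - cartan r.1 a.1.
Proof.
by move=> sa;
  rewrite affine_reflectionE aheightB aheightZ (simple_aheight sa) mulr1.
Qed.

(** Descent read backwards. The Cartan integer is negative, so [s_ a r] is [r] plus a positive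
    multiple of [a]; a property stable under positive combinations need only be checked on simple
    roots. *)
Lemma hat_ind (P : AV -> Prop) :
  (forall a, simple a -> P a) ->
  (forall a r, simple a -> affine_root r -> 0 < aheight r -> cartan r.1 a.1 < 0 ->
     P r -> P (s_ a r)) ->
  forall r, affine_root r -> 0 < aheight r -> P r.
Proof.
move=> Ps PD r rr hr; have [n hn] := ex_nat_gt (aheight r).
elim: n r rr hr hn => [|n IH] r rr hr hn; first by move: (lt_trans hr hn); rewrite ltxx.
have [/Ps //|nsr] := pselect (simple r).
have [a [sa rs hs hle]] := simple_descent rr hr nsr.
have Ps' := IH _ rs hs ltac:(by move: hn; rewrite -natr1; lra).
rewrite -[r](reflK (simple_root sa)); apply: PD => //.
have := aheight_refl (s_ a r) sa; rewrite (reflK (simple_root sa)).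
by lra.
Qed.

Lemma simple_reflection_sign a r : simple a -> affine_root r -> r <> a -> r <> - a ->
  aheight (s_ a r) < 0 <-> aheight r < 0.
Proof.
move=> sa rr ra rna; have rs := affine_root_refl (simple_root sa) rr.
have := aheight_neq0 rs; have := aheight_neq0 rr.
case: (ltgtP (aheight r) 0) => // hr _; last first.
  by have := simple_reflection_aheight sa rr hr ra; case: ltgtP.
have := @simple_reflection_aheight a (- r) sa (affine_rootN rr).
rewrite aheightN endN aheightN !oppr_gt0 => /(_ hr) h; split=> // _; apply: h.
by move=> e; apply: rna; rewrite -e opprK.
Qed.

(** * Reduced words and inversion sets *)

Definition word (al : seq AV) : 'End(AV) := word_prod (map (fun a => s_ a) al).

Definition simple_seq (al : seq AV) : Prop := forall a, a \in al -> simple a.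

Lemma simple_seq_cons a al : simple_seq (a :: al) <-> simple a /\ simple_seq al.
Proof.
split=> [h|[sa h] b]; last by rewrite inE => /predU1P[->|/h].
by split=> [|b bl]; apply: h; rewrite inE ?eqxx ?bl ?orbT.
Qed.

Lemma simple_seq_rcons al a : simple_seq (rcons al a) <-> simple_seq al /\ simple a.
Proof.
split=> [h|[h sa] b]; last by rewrite mem_rcons inE => /predU1P[->|/h].
by split=> [b bl|]; apply: h; rewrite mem_rcons inE ?eqxx ?bl ?orbT.
Qed.

Lemma word_cons a al : word (a :: al) = (s_ a \o word al)%VF.
Proof. by []. Qed.

Lemma word_rcons al a : word (rcons al a) = (word al \o s_ a)%VF.
Proof. by rewrite /word map_rcons word_prod_rcons. Qed.

Lemma simple_wordP s : simple_word s <->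
  exists2 al, simple_seq al & s = map (fun a => s_ a) al.
Proof.
split=> [|[al sal ->] _ /mapP[a /sal sa ->]]; last by exists a.
elim: s => [|x s IH]; first by exists [::].
case/simple_word_cons => -[a sa ->] /IH[al sal ->].
by exists (a :: al) => //; apply/simple_seq_cons.
Qed.

Lemma word_weyl al : simple_seq al -> W (word al).
Proof. by move=> sal; apply: simple_word_weyl; apply/simple_wordP; exists al. Qed.

(** Each letter adds a new inversion, [word al a], to those of the prefix. This is reducedness in a
    form suited to induction. *)
Inductive ascending : seq AV -> Prop :=
| ascending_nil : ascending [::]
| ascending_rcons al a :
    ascending al -> simple a -> 0 < aheight (word al a) -> ascending (rcons al a).

Lemma ascending_rconsE al a : ascending (rcons al a) ->
  [/\ ascending al, simple a & 0 < aheight (word al a)].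
Proof.
move e : (rcons al a) => l h; case: h e => [|bl b asc sb hb]; first by case: al.
by case/rcons_inj => -> ->.
Qed.

Lemma ascending_simple al : ascending al -> simple_seq al.
Proof. by elim=> // bl b _ sbl sb _; apply/simple_seq_rcons. Qed.

(** The exchange condition. Applying letters from the right, [a] first turns negative at some letter
    [b]; the letters after [b] then carry [a] to [b], so conjugation turns the final [s_ a] into an
    [s_ b] that cancels that letter. *)
Lemma exchange al a : simple_seq al -> simple a -> aheight (word al a) < 0 ->
  exists bl, [/\ simple_seq bl, word bl = (word al \o s_ a)%VF & (size bl < size al)%N].
Proof.
elim: al => [|b al IH] sal sa.
  by rewrite /word /= id_lfunE (simple_aheight sa) ltr10.
case/simple_seq_cons: sal => sb sal; rewrite word_cons comp_lfunE => h.
have [|hp] := ltP (aheight (word al a)) 0.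
  case/(IH sal sa) => bl [sbl e sz]; exists (b :: bl); split => //.
    exact/simple_seq_cons.
  by rewrite word_cons e comp_lfunA.
exists al; split => //.
have Wal := word_weyl sal; have ra := weyl_root Wal (simple_root sa).
have hp' : 0 < aheight (word al a) by rewrite lt0r hp aheight_neq0.
have e : word al a = b.
  apply: contrapT => ne; have := simple_reflection_aheight sb ra hp' ne.
  by move/(lt_trans h); rewrite ltxx.
rewrite -comp_lfunA (weyl_refl Wal) e comp_lfunA refl_sqr ?comp_lfun1l //.
exact: simple_root.
Qed.

Lemma inversions_simple x a r : W x -> simple a ->
  inversions Phi Pi (x \o s_ a)%VF r -> inversions Phi Pi x r \/ r = x a.
Proof.
move=> Wx sa; have Ws := weyl_simple sa; have ra := simple_root sa.
rewrite !inversionsE //; last exact: weylM.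
rewrite weyl_invM // refl_inv // comp_lfunE => -[rr hr].
have rx := weylV_root Wx rr.
have [e|ne] := pselect (x^-1%VF r = a); first by right; rewrite -e weylVK.
have [e|ne'] := pselect (x^-1%VF r = - a).
  by rewrite e endN refl_self // opprK (simple_aheight sa) ltr10.
by rewrite simple_reflection_sign //; left.
Qed.

(** [s_ a] changes the signs of [a] and [- a] only; positivity of [x a] ensures that [x a] is gained
    and nothing is lost. *)
Lemma inversions_ascent x a r : W x -> simple a -> 0 < aheight (x a) ->
  inversions Phi Pi (x \o s_ a)%VF r <-> inversions Phi Pi x r \/ r = x a.
Proof.
move=> Wx sa hxa; split; first exact: inversions_simple.
have Ws := weyl_simple sa; have ra := simple_root sa.
rewrite !inversionsE //; last exact: weylM.
rewrite weyl_invM // refl_inv // comp_lfunE.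
case=> [[rr hr hxr]|->]; last first.
  rewrite weylK // refl_self // aheightN (simple_aheight sa) ltrN10.
  by split=> //; exact: weyl_root.
split => //; rewrite simple_reflection_sign //; first exact: weylV_root.
  by move=> e; move: hxr; rewrite e (simple_aheight sa) ltr10.
by move=> e; move: hr; rewrite -[r](weylVK Wx) e endN aheightN; lra.
Qed.

Lemma inversions1 r : ~ inversions Phi Pi \1%VF r.
Proof.
rewrite inversionsE; last exact: weyl1.
by rewrite (inv_lfunE (comp_lfun1l _)) id_lfunE => -[_]; lra.
Qed.

Lemma inversions_word al : simple_seq al -> exists r : seq AV,
  size r = size al /\ forall rho, inversions Phi Pi (word al) rho -> rho \in r.
Proof.
elim/last_ind: al => [|al a IH].
  by exists [::]; split => // rho /inversions1.
case/simple_seq_rcons => sal sa; have [r [sr rP]] := IH sal.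
exists (word al a :: r); split; first by rewrite /= sr size_rcons.
move=> rho; rewrite word_rcons => /(inversions_simple (word_weyl sal) sa).
by case=> [/rP|->]; rewrite inE ?eqxx // => ->; rewrite orbT.
Qed.

Lemma inversions_ascending al : ascending al -> exists r : seq AV,
  [/\ uniq r, size r = size al & forall rho, rho \in r <-> inversions Phi Pi (word al) rho].
Proof.
elim=> [|bl b asc [r [ur sr rP]] sb hb].
  by exists [::]; split => // rho; split => // /inversions1.
have Wb := word_weyl (ascending_simple asc).
exists (word bl b :: r); split => /=; rewrite ?size_rcons ?sr ?ur ?andbT //.
  apply/negP => /rP; rewrite inversionsE // weylK // (simple_aheight sb) => -[_ _].
  by rewrite ltr10.
move=> rho; rewrite word_rcons inversions_ascent // inE -rP.
by split=> [/predU1P[->|->]|[->|->]]; [right|left|rewrite orbT|rewrite eqxx].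
Qed.

Local Notation reduced := (reduced dot Pi gamma).

(** An ascending word has as many inversions as letters, and no word for an element has fewer
    letters than the element has inversions. *)
Lemma ascending_reduced al : ascending al -> reduced (map (fun a => s_ a) al).
Proof.
move=> asc; split; first by apply/simple_wordP; exists al => //;
  exact: ascending_simple.
move=> _ /simple_wordP[bl sbl ->] e; rewrite !size_map.
have [r [ur <- rP]] := inversions_ascending asc.
have [r' [<- r'P]] := inversions_word sbl.
by apply: uniq_leq_size => // rho /rP; rewrite /word -e; exact: r'P.
Qed.

(** If the last letter gave no new inversion, the exchange condition would shorten the word. *)
Lemma reduced_ascending al : simple_seq al -> reduced (map (fun a => s_ a) al) ->
  ascending al.
Proof.
elim/last_ind: al => [|al a IH] sal; first by constructor.
case=> _ red; case/simple_seq_rcons: sal => sal sa.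
apply: ascending_rcons => //.
  apply: IH => //; split; first by apply/simple_wordP; exists al.
  move=> t st e; have := red (rcons t (s_ a));
    rewrite map_rcons !size_rcons ltnS; apply.
    by apply/simple_word_rcons; split => //; exists a.
  by rewrite !word_prod_rcons e.
have := aheight_neq0 (weyl_root (word_weyl sal) (simple_root sa)).
case: ltgtP => // /(exchange sal sa)[bl [sbl e sz]] _.
have := red (map (fun a => s_ a) bl); rewrite -/(word _) -/(word _) word_rcons e.
rewrite !size_map size_rcons leqNgt ltnS (ltnW sz) => /(_ _ erefl); apply.
by apply/simple_wordP; exists bl.
Qed.

Lemma weyl_ascending x : W x -> exists2 al, ascending al & x = word al.
Proof.
move=> /weyl_word[_ /simple_wordP[al sal ->] ->]; rewrite -/(word al).
have [n] := ubnP (size al); elim: n al sal => // n IH al sal sz.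
have [red|nred] := pselect (reduced (map (fun a => s_ a) al)).
  by exists al => //; exact: reduced_ascending.
suff [bl [sbl e sb]] : exists bl, [/\ simple_seq bl, word bl = word al & (size bl < size al)%N].
  by rewrite -e; apply: IH => //; apply: leq_trans sb sz.
apply: contrapT => nex; apply: nred; split; first by apply/simple_wordP; exists al.
move=> _ /simple_wordP[bl sbl ->] e; rewrite !size_map leqNgt; apply/negP => sb.
by apply: nex; exists bl.
Qed.

Lemma weyl_positive_id z : W z -> (forall a, simple a -> 0 < aheight (z a)) -> z = \1%VF.
Proof.
move=> /weyl_ascending[al asc ->] h; case: asc h => // bl b asc sb hb /(_ b sb).
rewrite word_rcons comp_lfunE refl_self ?endN ?aheightN; last exact: simple_root.
by rewrite oppr_gt0 ltNge ltW.
Qed.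

(** It suffices that [x^-1 \o y] keeps simple roots positive. If it made [a] negative, the positive
    one of [y a] and [- y a] would be an inversion of exactly one of [x] and [y]. *)
Lemma inversions_inj x y : W x -> W y ->
  inversions Phi Pi x = inversions Phi Pi y -> x = y.
Proof.
move=> Wx Wy e; have Vx := weylV Wx.
suff z1 : (x^-1 \o y = \1)%VF.
  by rewrite -[y]comp_lfun1l -(_ : (x \o x^-1 = \1)%VF) -?comp_lfunA ?z1 ?comp_lfun1r //;
    apply/lfunP => v; rewrite comp_lfunE id_lfunE weylVK.
apply: weyl_positive_id; first exact: weylM.
move=> a sa; rewrite comp_lfunE; have ra := simple_root sa.
have rya := weyl_root Wy ra.
have rxya := weylV_root Wx rya.
have eqi r : inversions Phi Pi x r <-> inversions Phi Pi y r by rewrite e.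
have := aheight_neq0 rxya; case: ltgtP => // hx _; exfalso.
have := aheight_neq0 rya; case: ltgtP => // hy _.
  have /eqi : inversions Phi Pi y (- y a).
    apply/inversionsE => //; rewrite endN weylK // !aheightN (simple_aheight sa).
    by split; [exact: affine_rootN|lra|lra].
  by rewrite inversionsE // endN !aheightN => -[_ _]; lra.
have /eqi : inversions Phi Pi x (y a) by apply/inversionsE.
by rewrite inversionsE // weylK // (simple_aheight sa) => -[_ _]; rewrite ltr10.
Qed.

(** [Q] acts as a new positive system, and [r] lists the finitely many positive roots that [x] sends
    outside it. Each reflection in a simple root sent outside [Q] shortens this list. Once none is
    left, [hat_ind] spreads [Q] to all positive roots. [G] is an invariant carried along the
    path. *)
Lemma chamber (Q : AV -> Prop) (G : 'End(AV) -> Prop) (x : 'End(AV)) (r : seq AV) :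
  (forall u v, Q u -> Q v -> Q (u + v)) ->
  (forall c v, 0 < c -> Q v -> Q (c *: v)) ->
  (forall rho, affine_root rho -> ~ Q rho -> Q (- rho)) ->
  (forall y, G y -> W y) ->
  (forall y a, G y -> simple a -> ~ Q (y a) -> G (y \o s_ a)%VF) ->
  G x -> (forall rho, affine_root rho -> 0 < aheight rho -> ~ Q (x rho) -> rho \in r) ->
  exists2 y, G y & forall rho, affine_root rho -> 0 < aheight rho -> Q (y rho).
Proof.
move=> QD QZ QN GW Gs; have [n] := ubnP (size r).
elim: n x r => // n IH x r szr Gx rP.
have [[a sa nQa]|nex] := pselect (exists2 a, simple a & ~ Q (x a)); last first.
  exists x => //; apply: hat_ind => [a sa|a rho sa _ _ c0 Qr].
    by apply: contrapT => nQ; apply: nex; exists a.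
  rewrite affine_reflectionE -scaleNr endD endZ; apply: QD => //; apply: QZ => //.
    by rewrite oppr_gt0.
  by apply: contrapT => nQ; apply: nex; exists a.
have ra := simple_root sa.
have ar : a \in r by apply: rP => //; rewrite (simple_aheight sa).
(* [s_ a] permutes the positive roots other than [a], so the new exceptions lie among the images of
   the old ones with [a] removed. *)
apply: (IH _ [seq s_ a y | y <- r & y != a] _ (Gs _ _ Gx sa nQa)).
  rewrite size_map size_filter -ltnS (leq_trans _ szr) // ltnS -(count_predC (pred1 a) r).
  by rewrite -[X in (X < _)%N]add0n ltn_add2r -has_count has_pred1.
move=> rho rr hr; rewrite comp_lfunE => nQ.
have ne : rho <> a.
  by move=> e; apply: nQ; rewrite e refl_self // endN; apply: QN => //;
    exact: weyl_root (GW _ Gx) _ _.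
apply/mapP; exists (s_ a rho); last by rewrite reflK.
rewrite mem_filter rP //; [rewrite andbT|exact: affine_root_refl|exact: simple_reflection_aheight].
apply/eqP => e; have := reflK ra rho; rewrite e refl_self // => e'.
by move: hr; rewrite -e' aheightN (simple_aheight sa); lra.
Qed.

(** * Orbit sets cut out by lexicographic cones *)

Definition off_weight (L : set V) (v : V) : R := coef (fun p => (~~ `[< L p >])%:R) v.

Lemma off_weight_simple L p : Pi p -> off_weight L p = (~~ `[< L p >])%:R.
Proof. exact: coef_simple. Qed.

Lemma off_weight_full v : off_weight Pi v = 0.
Proof.
rewrite /off_weight /coef big1 // => i _.
by rewrite asboolT ?mul0r //; apply/mem_Pis; rewrite mem_nth.
Qed.

Lemma off_weight_ge0 L a : Phi a -> 0 < height a -> 0 <= off_weight L a.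
Proof.
move=> Pa /(root_cone Pa) /coneP[c [c0 _ cE]]; rewrite /off_weight cE.
by apply: sumr_ge0 => p _; rewrite mulr_ge0.
Qed.

Lemma off_weight_subsystem L : L `<=` Pi ->
  root_subsystem dot Phi [set a | Phi a /\ off_weight L a = 0].
Proof.
move=> LP; split=> [a []//|a b [Pa la] [Pb lb]]; split; first exact: roots_reflection.
by rewrite /off_weight coefB coefZ -!/(off_weight _ _) la lb mulr0 subr0.
Qed.

(** The roots of weight 0 form a subsystem containing [L]. Conversely, a positive root is built up
    by [hat_ind] inside level 0; weights never decrease on the way, so weight 0 admits only simple
    roots from [L]. *)
Lemma generated_subsystemE L a : L `<=` Pi -> Phi a -> 0 < height a ->
  generated_subsystem dot Phi L a <-> off_weight L a = 0.
Proof.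
move=> LP Pa ha; split=> [|la Psi [[PsiP Psir] LPsi]].
  move/(_ [set a | Phi a /\ off_weight L a = 0]) => -[|_ //].
  split; first exact: off_weight_subsystem.
  move=> p Lp; split; first exact: Pi_Phi (LP _ Lp).
  by rewrite off_weight_simple ?asboolT //; exact: LP.
suff h : forall r : AV, affine_root r -> 0 < aheight r -> r.2 = 0 ->
    off_weight L r.1 = 0 -> Psi r.1.
  apply: (h (a, 0)) => //; first by split => //=; exact: rpred0.
  by rewrite /aheight /= mul0r addr0.
move=> {a Pa ha la}; apply: hat_ind => [_ [[p Pp <-] _|->]|a r sa rr hr c0 IH] /=.
- rewrite off_weight_simple //; case: asboolP => // Lp; first by move=> _;
  exact: LPsi.
  by move/eqP; rewrite oner_eq0.
- by move/eqP; rewrite oner_eq0.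
- have r20 : 0 <= r.2 by case: (aheight_pos_level rr hr) => [[->]|]; lra.
  rewrite refl_snd refl_fst; case: sa c0 => [[p Pp <-] /=|-> /= c0]; last by nra.
  rewrite mulr0 subr0 => c0 r2; have [[_ hr1]|r2'] := aheight_pos_level rr hr; last first.
    by move: r2'; rewrite r2; lra.
  have := off_weight_ge0 L (proj1 rr) hr1.
  rewrite /off_weight coefB coefZ -!/(off_weight _ _) -/(cartan _ _) => l0.
  rewrite (off_weight_simple _ Pp); case: asboolP => /= [Lp|_]; last by lra.
  by rewrite mulr0 subr0 => l; exact: (Psir _ _ (LPsi _ Lp) (IH r2 l)).
Qed.

Lemma positive_offE L a : L `<=` Pi ->
  positive_off dot Phi Pi L a <-> Phi a /\ 0 < off_weight L a.
Proof.
move=> LP; split.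
  case=> /positive_rootE[Pa ha] ng; split => //.
  rewrite lt0r off_weight_ge0 // andbT; apply/eqP => l0; apply: ng.
  exact/generated_subsystemE.
case=> Pa la; have ha : 0 < height a.
  have := height_root_neq0 Pa; case: ltgtP => // ha _.
  have := off_weight_ge0 L (rootN Pa); rewrite /height coefN oppr_gt0 => /(_ ha).
  by rewrite /off_weight coefN -/(off_weight _ _); lra.
split; first exact/positive_rootE.
by move/(generated_subsystemE LP Pa ha) => l0; move: la; rewrite l0 ltxx.
Qed.

(** The tie-break by height makes the cone contain exactly one of each pair of opposite affine
    roots. *)
Definition off_cone (L : set V) (v : AV) : Prop :=
  0 < off_weight L v.1 \/ (off_weight L v.1 = 0 /\ aheight v < 0).

Lemma off_coneD L u v : off_cone L u -> off_cone L v -> off_cone L (u + v).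
Proof.
rewrite /off_cone aheightD /= /off_weight coefD.
by case=> [lu|[lu hu]] [lv|[lv hv]]; [left|left|left|right; split]; lra.
Qed.

Lemma off_coneZ L c v : 0 < c -> off_cone L v -> off_cone L (c *: v).
Proof.
move=> c0; rewrite /off_cone aheightZ /= /off_weight coefZ.
by case=> [lv|[-> hv]]; [left; rewrite mulr_gt0|right; rewrite mulr0 pmulr_rlt0].
Qed.

Lemma off_coneN L v : affine_root v -> ~ off_cone L v <-> off_cone L (- v).
Proof.
move=> rv; rewrite /off_cone aheightN /= /off_weight coefN -/(off_weight _ _).
have := aheight_neq0 rv; set h := aheight v; set l := off_weight L v.1 => h0.
split=> [nE|[?|[? ?]] [?|[? ?]]]; try lra.
Qed.

Local Notation orbit_set w L :=
  (biclosed_action Phi Pi w (hat Phi Pi (positive_off dot Phi Pi L))).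

(** The action completes [G] by the negatives of the positive roots outside it, which selects one
    root of each opposite pair; the result is moved by [x] and cut back to the positive roots. *)
Lemma biclosed_actionE x G r : W x -> G `<=` hat_Phi ->
  biclosed_action Phi Pi x G r <->
  [/\ affine_root r, 0 < aheight r &
      G (x^-1%VF r) \/ (aheight (x^-1%VF r) < 0 /\ ~ G (- x^-1%VF r))].
Proof.
move=> Wx GP; split.
  case=> [[/inversionsE[//|rr hr hx] nG]|[[s Gs <-] nI]].
    split => //; right; split => // GN; apply: nG.
    by exists (x^-1%VF r); [exists (- x^-1%VF r); rewrite ?opprK|rewrite weylVK].
  have /hat_PhiE[rs hs] := GP _ Gs; have rxs := weyl_root Wx rs.
  split => //; last by left; rewrite weylK.
  have := aheight_neq0 rxs; case: ltgtP => // hxs _; case: nI.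
  exists (- x s); rewrite ?opprK //; apply/inversionsE => //.
  rewrite endN weylK // !aheightN oppr_gt0 oppr_lt0; split => //.
  exact: affine_rootN.
case=> rr hr [Gx|[hx nG]].
  right; split; first by exists (x^-1%VF r) => //; rewrite weylVK.
  case=> s /inversionsE[//|_ hs _] e.
  by move: hr; rewrite -e aheightN; lra.
left; split; first exact/inversionsE.
case=> _ [s Gs <-] e; apply: nG; rewrite -e weylK // opprK //.
Qed.

Lemma orbit_setE w L r : W w -> L `<=` Pi ->
  orbit_set w L r <-> [/\ affine_root r, 0 < aheight r & off_cone L (w^-1%VF r)].
Proof.
move=> Ww LP; have offP : positive_off dot Phi Pi L `<=` Phi by move=> a [[]].
have offE s : affine_root s ->
    hat Phi Pi (positive_off dot Phi Pi L) s <-> 0 < off_weight L s.1 /\ 0 < aheight s.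
  move=> rs; rewrite hatE //; have offE := positive_offE s.1 LP.
  by split=> [[_ /offE[_ ?] ?]|[? ?]]; split => //; apply/offE; split => //; case: rs.
rewrite biclosed_actionE //; last by move=> s /(hatE _ offP)[rs _ hs]; apply/hat_PhiE.
suff e : affine_root r -> (hat Phi Pi (positive_off dot Phi Pi L) (w^-1%VF r) \/
  (aheight (w^-1%VF r) < 0 /\ ~ hat Phi Pi (positive_off dot Phi Pi L) (- w^-1%VF r)))
  <-> off_cone L (w^-1%VF r) by split=> -[rr hr /(e rr)].
move=> rr; have rs := weylV_root Ww rr; rewrite !offE //; last exact: affine_rootN.
rewrite aheightN /off_cone /= /off_weight coefN -/(off_weight _ _).
have := aheight_neq0 rs; set h := aheight _; set l := off_weight _ _ => h0.
split.
  case=> [[l0 _]|[hn nl]]; first by left.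
  have [l0|l0|l0] := ltgtP l 0; [|by left|by right].
  by case: nl; lra.
case=> [l0|[l0 hn]]; last by right; split => // -[]; rewrite l0 oppr0 ltxx.
have [hn|hn|hn] := ltgtP h 0; [by right; split => // -[]; lra|by left|].
by rewrite hn eqxx in h0.
Qed.

Lemma cone_comb (E : AV -> Prop) u v (k1 k2 : R) :
  (forall u v, E u -> E v -> E (u + v)) ->
  (forall c v, 0 < c -> E v -> E (c *: v)) ->
  E u -> E v -> 0 <= k1 -> 0 <= k2 -> k1 *: u + k2 *: v != 0 -> E (k1 *: u + k2 *: v).
Proof.
move=> ED EZ Eu Ev; rewrite le0r => /orP[/eqP ->|k10]; rewrite le0r => /orP[/eqP ->|k20].
- by rewrite !scale0r addr0 eqxx.
- by rewrite scale0r add0r => _; apply: EZ.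
- by rewrite scale0r addr0 => _; apply: EZ.
- by move=> _; apply: ED; apply: EZ.
Qed.

(** [off_cone L] and its negative are both closed under positive combinations, and the negative cuts
    out the complement. *)
Lemma orbit_set_biclosed w L : W w -> L `<=` Pi -> biclosed Phi Pi (orbit_set w L).
Proof.
move=> Ww LP; have hat_neq0 r : 0 < aheight r -> r != 0.
  by apply: contraTN => /eqP ->; rewrite -(scale0r 0) aheightZ mul0r ltxx.
split.
- by move=> r /(orbit_setE _ Ww LP)[rr hr _]; apply/hat_PhiE.
- move=> a b k1 k2 /(orbit_setE _ Ww LP)[ra ha Ea] /(orbit_setE _ Ww LP)[rb hb Eb] k10 k20.
  move=> /hat_PhiE[rk hk]; apply/(orbit_setE _ Ww LP); split => //.
  apply: (@cone_comb (fun v => off_cone L (w^-1%VF v))) => //; last exact: hat_neq0.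
    by move=> u v; rewrite endD; exact: off_coneD.
  by move=> c v c0; rewrite endZ; exact: off_coneZ.
have compl r : (hat_Phi `\` orbit_set w L) r <->
    [/\ affine_root r, 0 < aheight r & off_cone L (- w^-1%VF r)].
  split=> [[/hat_PhiE[rr hr] nE]|[rr hr]].
    split => //; apply/off_coneN; first exact: weylV_root.
    by move=> E; apply: nE; apply/orbit_setE.
  move/(off_coneN _ (weylV_root Ww rr)) => nE; split; first exact/hat_PhiE.
  by move/(orbit_setE _ Ww LP) => -[].
move=> a b k1 k2 /compl[ra ha Ea] /compl[rb hb Eb] k10 k20.
move=> /hat_PhiE[rk hk]; apply/compl; split => //.
apply: (@cone_comb (fun v => off_cone L (- w^-1%VF v))) => //; last exact: hat_neq0.
  by move=> u v; rewrite endD opprD; exact: off_coneD.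
by move=> c v c0; rewrite endZ -scalerN; exact: off_coneZ.
Qed.

(** The weight off [Pi] is identically 0, so only the sign of [w^-1] matters: [L = Pi] accounts for
    the finite words. *)
Lemma orbit_set_full w : W w -> orbit_set w Pi = inversions Phi Pi w.
Proof.
move=> Ww; apply/seteqP; split=> r.
  move=> /(orbit_setE _ Ww (@subset_refl _ _))[rr hr]; rewrite /off_cone off_weight_full.
  by rewrite ltxx => -[//|[_ h]]; apply/inversionsE.
move=> /inversionsE[//|rr hr hx]; apply/orbit_setE => //; split => //; right; split => //.
by rewrite off_weight_full.
Qed.

(** * Galleries filling an orbit set *)

Lemma hat_level_finite N : exists r : seq AV,
  forall rho, affine_root rho -> 0 < aheight rho -> rho.2 < N%:R -> rho \in r.
Proof.
exists [seq (a, n%:R) | a <- finmap.enum_fset (fset_set Phi), n <- iota 0 N] => -[a c] rr hr /= cN.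
have c0 : 0 <= c by case: (aheight_pos_level rr hr) => /= [[->]|]; lra.
case: rr => /= Pa; rewrite intrEge0 // => /natrP[n cE].
rewrite cE in cN *; apply/allpairsP; exists (a, n); split => //=.
  by rewrite in_fset_set ?inE //; exact: roots_finite Phi_root.
by rewrite mem_iota /= add0n -(ltr_nat R).
Qed.

(** The finite parts of roots are finitely many and [f delta] is positive, so [f rho <= 0] bounds
    the level. *)
Lemma hat_nonpos_finite (f : AV -> R) :
  (forall u v, f (u + v) = f u + f v) -> (forall c v, f (c *: v) = c * f v) ->
  0 < f delta ->
  exists r : seq AV,
  forall rho, affine_root rho -> 0 < aheight rho -> f rho <= 0 -> rho \in r.
Proof.
move=> fD fZ f0.
have [N hN] := seq_bounded (finmap.enum_fset (fset_set Phi)) (fun a => - f (a, 0) / f delta).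
have [r hr] := hat_level_finite N; exists r => rho rr hrho frho; apply: hr => //.
have Pa : rho.1 \in finmap.enum_fset (fset_set Phi).
  by rewrite in_fset_set ?inE; [case: rr|exact: roots_finite Phi_root].
apply: le_lt_trans (hN _ Pa); rewrite ler_pdivlMr //.
suff : f rho = f (rho.1, 0) + rho.2 * f delta by lra.
by rewrite -fZ -fD -affine_splitE.
Qed.

Lemma inversions_finite x : W x -> exists r : seq AV,
  forall rho, rho \in r <-> inversions Phi Pi x rho.
Proof.
by move=> /weyl_ascending[al /inversions_ascending[r [_ _ rP]] ->]; exists r.
Qed.

Lemma orbit_set_infinite w L (r : seq AV) : W w -> L `<` Pi ->
  exists2 rho, orbit_set w L rho & rho \notin r.
Proof.
move=> Ww [LP] /existsNP[p /not_implyP[Pp nLp]].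
(* [N] pushes the level past every element of [r]; [M] makes the shifted root positive. *)
have [N hN] := seq_bounded r (fun rho => rho.2 - (w (p, 0)).2).
have [M hM] := ex_nat_gt (- aheight (w (p, 0)) / aheight delta).
have rp : affine_root (p, (N + M)%:R) by split => /=; [exact: Pi_Phi|rewrite natr_int].
have wE : w (p, (N + M)%:R) = w (p, 0) + (N + M)%:R *: delta.
  by rewrite [(p, _)]affine_splitE endD endZ weyl_delta.
exists (w (p, (N + M)%:R)).
  apply/orbit_setE => //; rewrite weylK //; split; first exact: weyl_root.
    rewrite wE aheightD aheightZ; have := aheight_delta => d0.
    move: hM; rewrite ltr_pdivrMr // natrD => hM.
    have : 0 <= N%:R :> R by []; nra.
  by left; rewrite off_weight_simple // asboolF.
apply/negP => /hN; rewrite wE /= -[_ *: _]/(_ * 1) mulr1 natrD.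
by have : 0 <= M%:R :> R by []; lra.
Qed.

Lemma ascending_cat al bl : ascending (al ++ bl) -> ascending al.
Proof.
elim/last_ind: bl => [|bl b IH]; first by rewrite cats0.
by rewrite -rcons_cat => /ascending_rconsE[/IH].
Qed.

Lemma inversions_cat al bl : ascending (al ++ bl) ->
  inversions Phi Pi (word al) `<=` inversions Phi Pi (word (al ++ bl)).
Proof.
elim/last_ind: bl => [|bl b IH]; first by rewrite cats0 => _ r.
rewrite -rcons_cat => /ascending_rconsE[asc sb hb] r /(IH asc) h.
rewrite word_rcons;
  apply/(inversions_ascent r (word_weyl (ascending_simple asc)) sb hb).
by left.
Qed.

(** The chamber of the cone [Q] below has the positive roots outside [Q] as inversions: an
    approximation of the orbit set from inside that is exact on [F]. Starting the reflections at
    [al] keeps [al] as a prefix. *)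
Lemma ascending_extension w L al (F : seq AV) : W w -> L `<=` Pi ->
  ascending al -> inversions Phi Pi (word al) `<=` orbit_set w L ->
  exists bl, [/\ ascending (al ++ bl),
    inversions Phi Pi (word (al ++ bl)) `<=` orbit_set w L &
    forall rho, rho \in F -> orbit_set w L rho ->
      inversions Phi Pi (word (al ++ bl)) rho].
Proof.
move=> Ww LP asc sub.
have Wal := word_weyl (ascending_simple asc).
have [rw rwP] := inversions_finite Ww; have [ra raP] := inversions_finite Wal.
pose l (v : AV) := off_weight L (w^-1%VF v).1.
pose h (v : AV) := aheight (w^-1%VF v).
have lD u v : l (u + v) = l u + l v by rewrite /l endD /= /off_weight coefD.
have lZ c v : l (c *: v) = c * l v by rewrite /l endZ /= /off_weight coefZ.
have hD u v : h (u + v) = h u + h v by rewrite /h endD aheightD.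
have hZ c v : h (c *: v) = c * h v by rewrite /h endZ aheightZ.
have hN v : h (- v) = - h v by rewrite -scaleN1r hZ mulN1r.
have lN v : l (- v) = - l v by rewrite -scaleN1r lZ mulN1r.
have h0 v : affine_root v -> h v != 0.
  by move=> rv; apply: aheight_neq0; exact: weylV_root.
(* The bound covers [F], the inversions [rw] of [w], which are the only positive roots with [h < 0],
   and the inversions [ra] of [al]. Where [l] vanishes the quotient is 0 and harmless. *)
have [N NP] := seq_bounded (F ++ rw ++ ra) (fun v => `|h v| / `|l v|).
pose M : R := N.+1%:R.
have M0 : 0 < M by rewrite ltr0n.
pose f v := h v - M * l v.
(* On the wall f = 0 the sign of h decides, so that Q is total on roots. *)
pose Q v := 0 < f v \/ (f v = 0 /\ 0 < h v).
have fD u v : f (u + v) = f u + f v by rewrite /f hD lD; ring.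
have fZ c v : f (c *: v) = c * f v by rewrite /f hZ lZ; ring.
have fN v : f (- v) = - f v by rewrite -scaleN1r fZ mulN1r.
have orbE v : orbit_set w L v <->
    [/\ affine_root v, 0 < aheight v & 0 < l v \/ (l v = 0 /\ h v < 0)].
  by rewrite orbit_setE.
have QF v : v \in F ++ rw ++ ra -> affine_root v ->
    ~ Q v <-> 0 < l v \/ (l v = 0 /\ h v < 0).
  move=> /NP vM /h0 hv; rewrite /Q /f; have [lv|lv|lv] := ltgtP (l v) 0.
  - have : `|h v| < M * `|l v|.
      rewrite -ltr_pdivrMr ?normr_gt0 ?lt_eqF // (lt_trans vM) //.
      by rewrite ltr_nat.
    by rewrite (ltr0_norm lv) ltr_norml => /andP[]; lra.
  - have : `|h v| < M * `|l v|.
      rewrite -ltr_pdivrMr ?normr_gt0 ?gt_eqF // (lt_trans vM) //.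
      by rewrite ltr_nat.
    by rewrite (gtr0_norm lv) ltr_norml => /andP[]; lra.
  - by rewrite lv mulr0 subr0; move: hv; case: (ltgtP (h v) 0) => // hv _; lra.
(* Off the list [h v > 0], so failing [Q] forces [M * l v >= h v > 0]. *)
have Qorb v : affine_root v -> 0 < aheight v -> ~ Q v -> orbit_set w L v.
  move=> rv hv nQ; apply/orbE; split => //.
  have [vF|] := boolP (v \in F ++ rw ++ ra); first exact/QF.
  rewrite !mem_cat !negb_or => /and3P[_ /negP nw _]; left.
  have : ~ h v < 0 by move=> hn; apply: nw; apply/rwP/inversionsE.
  by move: nQ; rewrite /Q /f; have := h0 _ rv; nra.
have QN v : affine_root v -> ~ Q v -> Q (- v).
  by rewrite /Q fN hN => /h0; lra.
pose G y := exists bl, [/\ ascending (al ++ bl), y = word (al ++ bl) &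
  forall rho, inversions Phi Pi y rho -> ~ Q rho].
have GW y : G y -> W y.
  by case=> bl [/ascending_simple /word_weyl + -> _].
have [r rP] : exists r : seq AV, forall rho, affine_root rho -> 0 < aheight rho ->
    f (word al rho) <= 0 -> rho \in r.
  apply: hat_nonpos_finite => [u v|c v|]; first by rewrite endD fD.
    by rewrite endZ fZ.
  rewrite weyl_delta // /f /h /l weylV_delta // /off_weight coef0 mulr0 subr0.
  exact: aheight_delta.
have QD u v : Q u -> Q v -> Q (u + v) by rewrite /Q fD hD; lra.
have QZ c v : 0 < c -> Q v -> Q (c *: v).
  move=> c0; rewrite /Q fZ hZ => -[fv|[-> hv]]; first by left; rewrite mulr_gt0.
  by right; rewrite mulr0 mulr_gt0.
have Gs y a : G y -> simple a -> ~ Q (y a) -> G (y \o s_ a)%VF.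
  move=> Gy sa nQ; have Wy := GW _ Gy; have rya := weyl_root Wy (simple_root sa).
  have [bl [ascy yE inv]] := Gy.
  (* If [y a] were negative, [- y a] would be an inversion of [y], hence outside [Q], yet totality
     puts it in [Q]. So every reflection lengthens the word. *)
  have hya : 0 < aheight (y a).
    have := aheight_neq0 rya; case: ltgtP => // hya _; exfalso.
    apply: (inv (- y a)); last exact: QN.
    apply/inversionsE => //; rewrite endN weylK // !aheightN (simple_aheight sa).
    by split; [exact: affine_rootN|lra|lra].
  exists (rcons bl a); rewrite -rcons_cat word_rcons -yE; split => //.
    by apply: ascending_rcons => //; rewrite -yE.
  by move=> rho /(inversions_ascent _ Wy sa hya)[/inv//|->].
have G0 : G (word al).
  exists [::]; rewrite cats0; split => // rho inv.
  have [rr hr _] := proj1 (inversionsE Wal rho) inv.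
  apply/QF => //; first by rewrite !mem_cat (proj2 (raP _) inv) !orbT.
  by have /orbE[] := sub _ inv.
have [|y [bl [ascy -> nQ] QP]] := chamber QD QZ QN GW Gs G0 (r := r).
  by move=> rho rr hr nQ; apply: rP => //; move: nQ; rewrite /Q; lra.
have Wy := word_weyl (ascending_simple ascy).
exists bl; split => // rho.
  by move=> inv; have [rr hr _] := proj1 (inversionsE Wy rho) inv; apply: Qorb => //; exact: nQ.
move=> rF /orbE[rr hr /(QF _ _ rr)] nQr; apply/inversionsE => //; split => //.
have ry := weylV_root Wy rr; have := aheight_neq0 ry; case: ltgtP => // hy _.
by case: nQr; [rewrite mem_cat rF|rewrite -(weylVK Wy rho); exact: QP].
Qed.

Local Notation infinite_reduced := (infinite_reduced dot Pi gamma).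

(** Stage [n] covers the orbit roots of level below [n], so the nested words exhaust the orbit
    set. *)
Lemma orbit_set_expression w L : W w -> L `<` Pi ->
  exists2 s, infinite_reduced s & expression_inversions Phi Pi s = orbit_set w L.
Proof.
move=> Ww LPi; have LP : L `<=` Pi by case: LPi.
pose ok al := ascending al /\ inversions Phi Pi (word al) `<=` orbit_set w L.
pose covers (n : nat) al := forall rho, orbit_set w L rho -> rho.2 < n%:R ->
  inversions Phi Pi (word al) rho.
have /choice[e eP] : forall z : nat * seq AV, exists b : seq AV, ok z.2 ->
    [/\ ok (z.2 ++ b), covers z.1 (z.2 ++ b) & (0 < size b)%N].
  move=> [n al] /=.
  have [[asc sub]|] := pselect (ok al); last by exists [::].
  have [ra raP] := inversions_finite (word_weyl (ascending_simple asc)).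
  (* A root of the infinite orbit set that is not yet inverted forces the extension to be
     nonempty. *)
  have [rho orho nrho] := orbit_set_infinite ra Ww LPi.
  have [F FP] := hat_level_finite n.
  have [bl [ascb subb cov]] := ascending_extension (rho :: F) Ww LP asc sub.
  exists bl => _; split => //.
    move=> sigma os sn; apply: cov => //.
    by have [rs hs _] := proj1 (orbit_setE _ Ww LP) os; rewrite inE FP ?orbT.
  rewrite lt0n size_eq0; apply/eqP => b0; move: (cov _ (mem_head _ _) orho).
  by rewrite b0 cats0 => /raP; exact/negP.
pose fix l (n : nat) : seq AV := if n is m.+1 then l m ++ e (m, l m) else [::].
have okl n : ok (l n).
  elim: n => [|n IH] /=; last by case: (eP (n, l n) IH).
  by split=> [|r /inversions1//]; constructor.
have lcat m n : exists bl, l (m + n)%N = l m ++ bl.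
  elim: n => [|n [bl IH]]; first by exists [::]; rewrite addn0 cats0.
  by rewrite addnS /= IH; exists (bl ++ e ((m + n)%N, l m ++ bl)); rewrite catA.
have lsize n : (n <= size (l n))%N.
  elim: n => // n IH /=; rewrite size_cat -addn1 leq_add //.
  by case: (eP (n, l n) (okl n)).
(* Stage [i.+1] has at least [i.+1] letters, so the default 0 is never returned. *)
pose s i := s_ (nth 0 (l i.+1) i).
have sE k : mkseq s k = map (fun a => s_ a) (take k (l k)).
  apply: (@eq_from_nth _ 0) => [|i]; first by rewrite size_mkseq size_map size_takel.
  rewrite size_mkseq => ik.
  rewrite nth_mkseq // (nth_map 0) ?size_takel // nth_take //; congr (s_ _).
  have [bl] := lcat i.+1 (k - i.+1)%N; rewrite subnKC // => ->.
  by rewrite [RHS]nth_cat (lsize i.+1).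
have asck k : ascending (take k (l k)).
  by apply: (@ascending_cat _ (drop k (l k))); rewrite cat_take_drop; case: (okl k).
exists s; first by move=> k; rewrite sE; exact: ascending_reduced.
apply/seteqP; split=> rho.
  case=> k _; rewrite sE -/(word _) => inv; have [asc] := okl k; apply.
  rewrite -(cat_take_drop k (l k)); apply: inversions_cat => //.
  by rewrite cat_take_drop.
move=> orho; have [n hn] := ex_nat_gt rho.2.
have [_ cov _] := eP (n, l n) (okl n).
pose k := size (l n.+1); exists k => //; rewrite sE -/(word _).
have [bl] := lcat n.+1 (k - n.+1)%N; rewrite subnKC; last exact: lsize.
by move=> ->; rewrite take_size_cat //; exact: cov.
Qed.

(** * Limits of increasing inversion sets *)

Section Limit.
Context (x : nat -> 'End(AV)).
Hypothesis Wx : forall k, W (x k).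
Hypothesis x_mono : forall k,
  inversions Phi Pi (x k) `<=` inversions Phi Pi (x k.+1).

Let Gam : set AV := \bigcup_k inversions Phi Pi (x k).
Let g k (v : AV) : R := aheight ((x k)^-1%VF v).

Definition tends_down (v : AV) : Prop :=
  forall C, exists N, forall k, (N <= k)%N -> g k v < C.

Definition stays_bounded (v : AV) : Prop := exists C, forall k, `|g k v| <= C.

Local Lemma gD k u v : g k (u + v) = g k u + g k v.
Proof. by rewrite /g endD aheightD. Qed.

Local Lemma gZ k c v : g k (c *: v) = c * g k v.
Proof. by rewrite /g endZ aheightZ. Qed.

Local Lemma gN k v : g k (- v) = - g k v.
Proof. by rewrite /g endN aheightN. Qed.

Local Lemma g_delta k : g k delta = aheight delta.
Proof. by rewrite /g weylV_delta. Qed.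

Lemma tends_downD u v : tends_down u -> tends_down v -> tends_down (u + v).
Proof.
move=> Du Dv C; have [N hN] := Du (C / 2); have [M hM] := Dv (C / 2).
exists (N + M)%N => k NMk; rewrite gD.
have := hN k ltac:(lia); have := hM k ltac:(lia); lra.
Qed.

Lemma tends_down_bounded u v : tends_down u -> stays_bounded v -> tends_down (u + v).
Proof.
move=> Du [B hB] C; have [N hN] := Du (C - B); exists N => k /hN; rewrite gD.
by have := hB k; rewrite ler_norml => /andP[]; lra.
Qed.

Lemma tends_downZ c v : 0 < c -> tends_down v -> tends_down (c *: v).
Proof.
move=> c0 Dv C; have [N hN] := Dv (C / c); exists N => k /hN.
by rewrite gZ ltr_pdivlMr // mulrC.
Qed.

Lemma stays_boundedD u v : stays_bounded u -> stays_bounded v -> stays_bounded (u + v).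
Proof.
move=> [B hB] [C hC]; exists (B + C) => k; rewrite gD.
by rewrite (le_trans (ler_normD _ _)) // lerD.
Qed.

Lemma stays_boundedZ c v : stays_bounded v -> stays_bounded (c *: v).
Proof.
by move=> [B hB]; exists (`|c| * B) => k; rewrite gZ normrM ler_wpM2l.
Qed.

Lemma stays_boundedN v : stays_bounded v -> stays_bounded (- v).
Proof. by move=> [B hB]; exists B => k; rewrite gN normrN. Qed.

Lemma stays_bounded_delta : stays_bounded delta.
Proof. by exists `|aheight delta| => k; rewrite g_delta. Qed.

Lemma tends_down_unbounded v : tends_down v -> ~ stays_bounded v.
Proof.
move=> Dv [B hB]; have [N hN] := Dv (- B).
by have := hN N (leqnn N); have := hB N; rewrite ler_norml => /andP[]; lra.
Qed.

Lemma tends_down_asym v : tends_down v -> ~ tends_down (- v).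
Proof.
move=> Dv DNv; have [N hN] := Dv 0; have [M hM] := DNv 0.
have := hN (N + M)%N ltac:(lia); have := hM (N + M)%N ltac:(lia).
by rewrite gN; lra.
Qed.

Lemma inversions_mono m n : (m <= n)%N ->
  inversions Phi Pi (x m) `<=` inversions Phi Pi (x n).
Proof.
move=> /subnKC <-; elim: (n - m)%N => [|k IH]; first by rewrite addn0.
by rewrite addnS => r /IH /x_mono.
Qed.

Local Lemma inversions_g k r : affine_root r -> 0 < aheight r ->
  inversions Phi Pi (x k) r <-> g k r < 0.
Proof. by move=> rr hr; rewrite inversionsE //; split=> [[]|]. Qed.

Local Lemma g_split k v : g k v = g k (v.1, 0) + v.2 * aheight delta.
Proof. by rewrite {1}[v]affine_splitE gD gZ g_delta. Qed.

(** Either every a + (n + 1) delta becomes an inversion, which pushes the heights of [a] below any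
    bound, or some such root never does, and its nonnegative heights bound those of [a] from
    below. *)
Local Lemma tends_down_or_lower a : Phi a ->
  tends_down (a, 0) \/ exists C, forall k, C <= g k (a, 0).
Proof.
move=> Pa; have d0 := aheight_delta.
have rn n : affine_root (a, n.+1%:R) by split; rewrite //= natr_int.
have hn n : 0 < aheight (a, n.+1%:R) by apply: aheight_level_pos;
  rewrite //= -natr1 lerDr.
have [all|/existsNP[n nG]] := pselect (forall n, Gam (a, n.+1%:R)); [left|right].
  move=> C; have [n hC] := ex_nat_gt (- C / aheight delta).
  have [N _ inv] := all n; exists N => k Nk.
  have /inversions_g := inversions_mono Nk inv;
    rewrite g_split /= => /(_ (rn n) (hn n)).
  move: hC; rewrite ltr_pdivrMr // -natr1; lra.
exists (- (n.+1%:R * aheight delta)) => k.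
rewrite -subr_ge0 opprK -(g_split _ (a, n.+1%:R)) leNgt.
by apply/negP => gk; apply: nG; exists k => //; exact/inversions_g.
Qed.

(** The dichotomy applies to the finite part and to its negative; lower bounds for both mean
    boundedness. The level shifts heights only by a constant. *)
Lemma root_trichotomy r : affine_root r ->
  [\/ tends_down r, stays_bounded r | tends_down (- r)].
Proof.
move=> [Pr _]; have bd := stays_boundedZ r.2 stays_bounded_delta.
have Ne : - r = (- r.1, 0) + - (r.2 *: delta).
  by rewrite [r in LHS]affine_splitE opprD; congr (_ + _); congr pair; rewrite /= oppr0.
have [D1|[C hC]] := tends_down_or_lower Pr.
  by apply: Or31; rewrite [r]affine_splitE; exact: tends_down_bounded.
have [D2|[B hB]] := tends_down_or_lower (rootN Pr).
  by apply: Or33; rewrite Ne; apply: tends_down_bounded => //;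
    exact: stays_boundedN.
apply: Or32; rewrite [r]affine_splitE; apply: stays_boundedD => //.
exists (`|C| + `|B|) => k; have := hC k; have := hB k.
have -> : (- r.1, 0) = - (r.1, 0) :> AV by congr pair; rewrite /= oppr0.
rewrite gN ler_norml; have := ler_norm (- C); have := ler_norm (- B).
by rewrite !normrN; have := normr_ge0 C; have := normr_ge0 B; lra.
Qed.

(** An inversion has negative height, so a bound on the finite part bounds the level. Only finitely
    many bounded roots are ever inverted, and one stage serves them all. *)
Lemma bounded_inversions_stabilize : exists K, forall r, affine_root r ->
  0 < aheight r -> stays_bounded r -> Gam r -> inversions Phi Pi (x K) r.
Proof.
have d0 := aheight_delta.
have /choice[C hC] : forall a : V, exists C, stays_bounded (a, 0) ->
    forall k, `|g k (a, 0)| <= C.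
  move=> a; have [[C hC]|nb] := pselect (stays_bounded (a, 0)); first by exists C.
  by exists 0.
have [N hN] := seq_bounded (finmap.enum_fset (fset_set Phi)) (fun a => C a / aheight delta).
have [s sP] := hat_level_finite N.
have /choice[e eP] : forall r : AV, exists k, Gam r -> inversions Phi Pi (x k) r.
  move=> r; have [[k _ inv]|nG] := pselect (Gam r); first by exists k.
  by exists 0%N.
have [K hK] := seq_bounded s (fun r => (e r)%:R : R); exists K => r rr hr bd Gr.
have inv := eP r Gr.
apply: (inversions_mono _ inv); apply: ltnW; rewrite -(ltr_nat R); apply: hK.
apply: sP => //.
have b0 : stays_bounded (r.1, 0).
  have -> : (r.1, 0) = r + (- r.2) *: delta :> AV.
    by apply: (addIr (r.2 *: delta)); rewrite -affine_splitE scaleNr subrK.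
  by apply: stays_boundedD => //; apply: stays_boundedZ; exact: stays_bounded_delta.
have Pr : r.1 \in finmap.enum_fset (fset_set Phi).
  by rewrite in_fset_set ?inE; [case: rr|exact: roots_finite Phi_root].
apply: lt_trans (hN _ Pr); rewrite ltr_pdivlMr //.
have := proj1 (inversions_g _ rr hr) inv; rewrite (g_split _ r).
by have := hC _ b0 (e r); rewrite ler_norml => /andP[]; lra.
Qed.

(** [Gam] consists of the positive roots that tend down and the bounded ones inverted at stage [K];
    weight and height in the chamber of [x K \o u] encode these two cases. A constant sequence gives
    [L = Pi], so properness is not claimed. *)
Lemma limit_orbit_set : exists w L, [/\ W w, L `<=` Pi & Gam = orbit_set w L].
Proof.
have [K hK] := bounded_inversions_stabilize.
have WK := Wx K.
have GamE r : affine_root r -> 0 < aheight r ->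
    Gam r <-> tends_down r \/ (stays_bounded r /\ g K r < 0).
  move=> rr hr; split=> [Gr|[Dr|[bd gr]]].
  - have [Dr|bd|Dr] := root_trichotomy rr; first by left.
      by right; split => //; apply/inversions_g => //; exact: hK.
    have [k _ inv] := Gr; have [N hN] := Dr 0.
    have := hN (N + k)%N ltac:(lia).
    have /inversions_g := inversions_mono (leq_addl N k) inv.
    by rewrite gN => /(_ rr hr); lra.
  - by have [N hN] := Dr 0; exists N => //; apply/inversions_g => //; exact: hN.
  - by exists K => //; exact/inversions_g.
pose Lo v := tends_down (x K v); pose Bd v := stays_bounded (x K v).
have LoD u v : Lo u -> Lo v -> Lo (u + v).
  by rewrite /Lo endD; exact: tends_downD.
have LoBd u v : Lo u -> Bd v -> Lo (u + v).
  by rewrite /Lo endD; exact: tends_down_bounded.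
have BdD u v : Bd u -> Bd v -> Bd (u + v).
  by rewrite /Bd endD; exact: stays_boundedD.
have LoZ c v : 0 < c -> Lo v -> Lo (c *: v).
  by rewrite /Lo endZ; exact: tends_downZ.
have BdZ c v : Bd v -> Bd (c *: v).
  by rewrite /Bd endZ; exact: stays_boundedZ.
have BdN v : Bd v -> Bd (- v).
  by rewrite /Bd endN; exact: stays_boundedN.
have Bd_delta : Bd delta.
  by rewrite /Bd weyl_delta //; exact: stays_bounded_delta.
have tri v : affine_root v -> [\/ Lo v, Bd v | Lo (- v)].
  by rewrite /Lo /Bd endN => rv; apply: root_trichotomy; exact: weyl_root.
have LoNBd v : Lo v -> ~ Bd v by exact: tends_down_unbounded.
(* Comparing levels first forces the chamber of Q to be reached by reflections
   in Pi alone, hence by an element of the finite Weyl group. *)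
pose Q (v : AV) := 0 < v.2 \/ (v.2 = 0 /\ (Lo v \/ (Bd v /\ 0 < aheight v))).
have QD u v : Q u -> Q v -> Q (u + v).
  rewrite /Q aheightD /=.
  case=> [u2|[u2 hu]] [v2|[v2 hv]]; [left; lra|left; lra|left; lra|right].
  split; first lra.
  case: hu hv => [Lu|[Bu hu]] [Lv|[Bv hv]]; [left|left|left|right].
  - exact: LoD.
  - exact: LoBd.
  - by rewrite addrC; exact: LoBd.
  - by split; [exact: BdD|lra].
have QZ c v : 0 < c -> Q v -> Q (c *: v).
  rewrite /Q aheightZ /= -[c *: v.2]/(c * v.2) => c0.
  case=> [v2|[-> hv]]; [by left; rewrite mulr_gt0|right; rewrite mulr0; split => //].
  by case: hv => [/LoZ|[/BdZ Bv hv]]; [by left; auto|right; rewrite mulr_gt0].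
have QN v : affine_root v -> ~ Q v -> Q (- v).
  move=> rv nQ; rewrite /Q aheightN /=; have [v2|v2|v2] := ltgtP v.2 0.
  - by left; rewrite oppr_gt0.
  - by case: nQ; left.
  - right; rewrite v2 oppr0; split => //; case: (tri _ rv) => [Lv|Bv|]; last by left.
      by case: nQ; right; split => //; left.
    right; split; first exact: BdN.
    rewrite oppr_gt0; have := aheight_neq0 rv; case: ltgtP => // hv _.
    by case: nQ; right; split => //; right.
pose G (y : 'End(AV)) := W y /\ forall v, (y v).2 = v.2.
have GW y : G y -> W y by case.
have Gs y a : G y -> simple a -> ~ Q (y a) -> G (y \o s_ a)%VF.
  move=> [Wy y2] sa nQ; split; first by apply: weylM => //; exact: weyl_simple.
  move=> v; rewrite comp_lfunE y2 refl_snd.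
  case: sa nQ => [[p _ <-] _|->]; first by rewrite /= mulr0 subr0.
  by case; left; rewrite y2 ltr01.
have G1 : G \1%VF by split; [exact: weyl1|move=> v; rewrite id_lfunE].
have [r rP] := hat_level_finite 1.
have [|u [Wu u2] Qu] := chamber QD QZ QN GW Gs G1 (r := r).
  move=> rho rr hr; rewrite id_lfunE => nQ; apply: rP => //.
  by rewrite ltNge; apply/negP => r1; apply: nQ; left; apply: lt_le_trans r1.
(* By [Qu] the image under [u] of a simple root either tends down or stays bounded; the bounded case
   defines [L]. *)
pose L := [set p | Pi p /\ Bd (u (p, 0))].
have LP : L `<=` Pi by move=> p [].
have QuP p : Pi p -> Lo (u (p, 0)) \/ Bd (u (p, 0)).
  move=> Pp; have sp : simple (p, 0) by left; exists p.
  have := Qu _ (simple_root sp) ltac:(by rewrite (simple_aheight sp)).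
  by rewrite /Q u2 ltxx => -[//|[_ [|[]]]]; [left|right].
(* Tending down dominates boundedness in sums just as positive weight dominates weight 0, so the two
   match along [hat_ind]. Reflecting in delta - gamma would leave level 0. *)
have level0 : forall rho : AV, affine_root rho -> 0 < aheight rho -> rho.2 = 0 ->
    (Lo (u rho) /\ 0 < off_weight L rho.1) \/ (Bd (u rho) /\ off_weight L rho.1 = 0).
  apply: hat_ind => [_ [[p Pp <-] _|->]|a rho sa rr hr c0 IH] /=.
  - rewrite (off_weight_simple _ Pp); case: asboolP => [[_ Bp]|nL] /=; first by right.
    by left; split=> //; case: (QuP _ Pp) => // Bp; case: nL.
  - by move/eqP; rewrite oner_eq0.
  - have r20 : 0 <= rho.2 by case: (aheight_pos_level rr hr) => [[->]|]; lra.
    rewrite refl_snd; case: sa c0 => [[p Pp <-] /=|-> /= c0]; last by nra.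
    rewrite mulr0 subr0 => c0 /IH{}IH.
    rewrite affine_reflectionE -/(cartan _ _) -scaleNr /= in c0 *.
    rewrite endD endZ /off_weight coefD coefZ -!/(off_weight _ _) (off_weight_simple _ Pp).
    have c0' : 0 < - cartan rho.1 p by lra.
    case: asboolP => /= [[_ Bp]|nL].
      rewrite mulr0 addr0; case: IH => -[IH1 IH2]; [left|right]; split => //.
        by apply: LoBd => //; exact: BdZ.
      by apply: BdD => //; exact: BdZ.
    have Lp : Lo (u (p, 0)) by case: (QuP _ Pp) => // Bp; case: nL.
    left; rewrite mulr1; case: IH => -[IH1 IH2]; split; try lra.
      by apply: LoD => //; exact: LoZ.
    by rewrite addrC; apply: LoBd => //; exact: LoZ.
have uD v : u v = u (v.1, 0) + v.2 *: delta.
  by rewrite {1}[v]affine_splitE endD endZ weyl_delta.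
have BdZd c : Bd (c *: delta) by exact: BdZ.
have trans rho : affine_root rho -> 0 < height rho.1 ->
    (Lo (u rho) /\ 0 < off_weight L rho.1) \/ (Bd (u rho) /\ off_weight L rho.1 = 0).
  move=> [Pr _] hr; rewrite uD.
  have r0 : affine_root (rho.1, 0) by split => //=; exact: rpred0.
  have h0 : 0 < aheight (rho.1, 0) by rewrite /aheight /= mul0r addr0.
  case: (level0 _ r0 h0 erefl) => /= -[h1 h2]; [left|right]; split => //.
    exact: LoBd.
  exact: BdD.
have transT rho : affine_root rho ->
    [\/ Lo (u rho) /\ 0 < off_weight L rho.1, Bd (u rho) /\ off_weight L rho.1 = 0 |
       Lo (- u rho) /\ off_weight L rho.1 < 0].
  move=> rr; have := height_root_neq0 (proj1 rr).
  case: (ltgtP (height rho.1)) => // hr _; last first.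
    by case: (trans rho rr hr); [exact: Or31|exact: Or32].
  have := trans (- rho) (affine_rootN rr);
    rewrite /= /height coefN oppr_gt0 => /(_ hr).
  rewrite endN /off_weight coefN -/(off_weight _ _) => -[[h1 h2]|[h1 h2]].
    by apply: Or33; split => //; lra.
  by apply: Or32; split; [rewrite -[u _]opprK; exact: BdN|lra].
(* On bounded roots [Q] amounts to positivity, so [u] preserves their sign. *)
have hu_pos rho : affine_root rho -> Bd (u rho) -> 0 < aheight rho -> 0 < aheight (u rho).
  move=> rr Br hr; have := Qu _ rr hr; rewrite /Q => -[u2r|[_ [/LoNBd//|[]//]]].
  have ru := weyl_root Wu rr; apply: aheight_level_pos => //.
  by case: (int_cmp (proj2 ru)) => // h; lra.
have hu_neg rho : affine_root rho -> Bd (u rho) -> aheight (u rho) < 0 <-> aheight rho < 0.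
  move=> rr Br; have hp := hu_pos rho rr Br.
  have := hu_pos (- rho) (affine_rootN rr);
    rewrite endN !aheightN => /(_ (BdN _ Br)).
  have := aheight_neq0 rr; have := aheight_neq0 (weyl_root Wu rr).
  by move: hp; lra.
exists (x K \o u)%VF, L; split => //; first exact: weylM.
apply/seteqP; split=> rho.
  move=> Gr; have [k _ /inversionsE[//|rr hr _]] := Gr.
  apply/orbit_setE => //; first exact: weylM.
  split => //; move/(GamE _ rr hr): Gr.
  rewrite weyl_invM // comp_lfunE; set sg := (u^-1)%VF _.
  have usg : u sg = ((x K)^-1)%VF rho by rewrite weylVK.
  have rsg : affine_root sg by apply: weylV_root => //; exact: weylV_root.
  have xusg : x K (u sg) = rho by rewrite usg weylVK.
  rewrite /g -usg -xusg -/(Lo _) -/(Bd _) => E; rewrite /off_cone.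
  have [[Lu l0]|[Bu l0]|[Lu l0]] := transT sg rsg.
  - by left.
  - by case: E => [/LoNBd//|[_ /(hu_neg sg rsg Bu)]]; right.
  - case: E => [Lu'|[/BdN/LoNBd]] //.
    by case: (tends_down_asym Lu'); rewrite -endN.
move=> /orbit_setE[||rr hr]; [exact: weylM|exact: LP|].
rewrite weyl_invM // comp_lfunE; set sg := (u^-1)%VF _.
have usg : u sg = ((x K)^-1)%VF rho by rewrite weylVK.
have rsg : affine_root sg by apply: weylV_root => //; exact: weylV_root.
have xusg : x K (u sg) = rho by rewrite usg weylVK.
move=> E; apply/(GamE _ rr hr); rewrite /g -usg -xusg -/(Lo _) -/(Bd _).
have [[Lu l0]|[Bu l0]|[Lu l0]] := transT sg rsg; first by left.
  by right; split=> //; apply/hu_neg => //; case: E => [|[]//]; rewrite l0 ltxx.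
by case: E; lra.
Qed.

End Limit.

(** * The two bijections *)

Lemma infinite_reducedP s : infinite_reduced s -> exists2 a : nat -> AV,
  forall k, ascending (mkseq a k) &
  forall k, word_prod (mkseq s k) = word (mkseq a k).
Proof.
move=> red; have /choice[a aP] : forall i, exists a, simple a /\ s_ a = s i.
  move=> i; have [sw _] := red i.+1; have [|a sa e] := sw (s i); last by exists a.
  by rewrite mkseqS mem_rcons mem_head.
have sE k : mkseq s k = map (fun a => s_ a) (mkseq a k).
  by rewrite /mkseq -map_comp; apply: eq_map => i /=; case: (aP i).
exists a => k; last by rewrite sE.
apply: reduced_ascending; last by rewrite -sE.
by move=> _ /mapP[i _ ->]; case: (aP i).
Qed.

(** [inversions w] is finite, while initial segments have arbitrarily many inversions. *)
Lemma expression_not_inversions s w : infinite_reduced s -> W w ->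
  expression_inversions Phi Pi s <> inversions Phi Pi w.
Proof.
move=> /infinite_reducedP[a asc sE] /inversions_finite[r rP] e.
have [r' [ur' sr' r'P]] := inversions_ascending (asc (size r).+1).
suff : (size r' <= size r)%N by rewrite sr' size_mkseq ltnn.
apply: uniq_leq_size => // rho /r'P inv; apply/rP; rewrite -e.
by exists (size r).+1; rewrite ?sE.
Qed.

Lemma expression_orbit_set s : infinite_reduced s -> exists w L,
  [/\ W w, L `<` Pi & expression_inversions Phi Pi s = orbit_set w L].
Proof.
move=> red; have [a asc sE] := infinite_reducedP red.
have Wx k : W (word_prod (mkseq s k)).
  by rewrite sE; exact: word_weyl (ascending_simple (asc k)).
have x_mono k : inversions Phi Pi (word_prod (mkseq s k)) `<=`
    inversions Phi Pi (word_prod (mkseq s k.+1)).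
  by rewrite !sE mkseqS -cats1; apply: inversions_cat; rewrite cats1 -mkseqS;
    exact: asc.
have [w [L [Ww LP e]]] := limit_orbit_set Wx x_mono.
exists w, L; split => //; split => // PL.
(* With [L = Pi] the union would be the inversion set of the single element [w]. *)
have LE : L = Pi by apply/seteqP.
move: e; rewrite LE orbit_set_full // => e.
exact: (expression_not_inversions red Ww e).
Qed.

Lemma word_inversionsE s : infinite_reduced s ->
  word_inversions Phi Pi [set t | infinite_reduced t /\
    expression_inversions Phi Pi t = expression_inversions Phi Pi s] =
  expression_inversions Phi Pi s.
Proof.
move=> red; apply/seteqP; split=> [r [t [_ <-]] //|r sr].
by exists s.
Qed.

Local Notation words := (infinite_words dot Phi Pi gamma).

Lemma infinite_words_bij :
  set_bij words (proper_orbit_sets dot Phi Pi) (word_inversions Phi Pi).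
Proof.
split.
- move=> _ [s red ->]; rewrite word_inversionsE //.
  by have [w [L [Ww LP ->]]] := expression_orbit_set red; exists w, L.
(* A class is determined by the inversion set of any member. *)
- move=> u v /set_mem[s reds ->] /set_mem[t redt ->].
  by rewrite !word_inversionsE // => ->.
- move=> _ [w [L [Ww LP ->]]]; have [s red e] := orbit_set_expression Ww LP.
  eexists; first by exists s.
  by rewrite word_inversionsE.
Qed.

Lemma all_words_bij :
  set_bij (all_words dot Phi Pi gamma) (orbit_sets dot Phi Pi)
    (all_word_inversions Phi Pi).
Proof.
have [wfun winj wsurj] := infinite_words_bij; split.
- move=> _ [[u uw <-]|[w Ww <-]] /=.
    by have [w [L [Ww [LP _] ->]]] := wfun u uw; exists w, L.
  by exists w, Pi; split; rewrite ?orbit_set_full //; exact: subset_refl.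
- have neq u w : words u -> W w -> word_inversions Phi Pi u <> inversions Phi Pi w.
    by move=> [s red ->]; rewrite word_inversionsE //; exact: expression_not_inversions.
  move=> _ _ /set_mem[[u uw <-]|[x Wx <-]] /set_mem[[v vw <-]|[y Wy <-]] //= e.
  + by congr inl; apply: winj => //; exact: mem_set.
  + by case: (neq u y).
  + by case: (neq v x).
  + by congr inr; exact: inversions_inj.
- move=> _ [w [L [Ww LP ->]]]; have [->|nLP] := pselect (L = Pi).
    by exists (inr w) => /=; [right; exists w|rewrite orbit_set_full].
  have [|u uw ue] := wsurj (orbit_set w L).
    by exists w, L; split => //; split => // PL; apply: nLP; apply/seteqP.
  by exists (inl u) => //; left; exists u.
Qed.

Lemma orbit_sets_biclosed : orbit_sets dot Phi Pi `<=` biclosed Phi Pi.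
Proof. by move=> _ [w [L [Ww LP ->]]]; exact: orbit_set_biclosed. Qed.

End RootSystem.

Theorem theorem3p12 (R : realType) (V : vectType R) (dot : {dot V for idfun})
    (Phi Pi : set V) (gamma : V)
    (Phi_root : crystallographic_root_system dot Phi)
    (Phi_irr : irreducible_roots dot Phi)
    (Pi_simple : simple_system Phi Pi)
    (gamma_highest : highest_root Phi Pi gamma) :
  (proper_orbit_sets dot Phi Pi `<=` biclosed Phi Pi /\
   set_bij (infinite_words dot Phi Pi gamma) (proper_orbit_sets dot Phi Pi)
     (word_inversions Phi Pi)) /\
  (orbit_sets dot Phi Pi `<=` biclosed Phi Pi /\
   set_bij (all_words dot Phi Pi gamma) (orbit_sets dot Phi Pi)
     (all_word_inversions Phi Pi)).
Proof.
have biclosed_orbits := orbit_sets_biclosed Phi_root Pi_simple gamma_highest.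
split; split => //.
- move=> G [w [L [Ww [LP _] GE]]]; apply: biclosed_orbits.
  by exists w, L.
- exact: infinite_words_bij.
- exact: all_words_bij.
Qed.
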